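(* Let $(X,T,\mathcal{L},\mathcal{M},\mathcal{R})$ be a KTQ and let $F$ be a compact oriented surface (or a plane). Let $D$ and $D'$ be oriented link diagrams on $F$ such that $D'$ is obtained from $D$ by one Reidemeister move performed inside a disk $U\subset F$, and let $\mathcal{C}$, $\mathcal{C}'$ be KTQ colorings by $X$ of $D$, $D'$, respectively, which agree on $F\setminus U$. Let $c_D$, $c_{D'}\in C_1(X)$ be the cycles assigned to the colored diagrams $(D,\mathcal{C})$ and $(D',\mathcal{C}')$. Then: (i) for a first, second or third Reidemeister move (of any oriented type), $c_D$ and $c_{D'}$ represent the same class in $H_1^{N}(X)$; (ii) for a second or third Reidemeister move (of any oriented type), $c_D$ and $c_{D'}$ represent the same class in $H_1(X)$. That is, the homology class of the cycle assigned to a KTQ-colored oriented link diagram is invariant under all Reidemeister moves in $H^{N}(X)$, and under the second and third Reidemeister moves in the unnormalized homology $H(X)$.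
   Context: A ternary quasigroup $(X,T,\mathcal{L},\mathcal{M},\mathcal{R})$ is a set $X$ with ternary operations $T,\mathcal{L},\mathcal{M},\mathcal{R}\colon X^3\to X$ such that for all $x_1,x_2,x_3\in X$: $\mathcal{L}(T(x_1,x_2,x_3),x_2,x_3)=x_1=T(\mathcal{L}(x_1,x_2,x_3),x_2,x_3)$; $\mathcal{M}(x_1,T(x_1,x_2,x_3),x_3)=x_2=T(x_1,\mathcal{M}(x_1,x_2,x_3),x_3)$; $\mathcal{R}(x_1,x_2,T(x_1,x_2,x_3))=x_3=T(x_1,x_2,\mathcal{R}(x_1,x_2,x_3))$. A KTQ (knot-theoretic ternary quasigroup) is a ternary quasigroup satisfying, for all $a,b,c,d\in X$: (A3L) $T(T(a,b,c),c,d)=T\big(T(a,b,T(b,c,d)),\,T(b,c,d),\,d\big)$; (A3R) $T(a,b,T(b,c,d))=T\big(a,\,T(a,b,c),\,T(T(a,b,c),c,d)\big)$. Diagrams and colorings. A link diagram on $F$ is a generic immersed collection of closed curves on $F$ with over/under information at each crossing. The regions of $D$ are the connected components of the complement in $F$ of the underlying curves. A KTQ coloring of an oriented diagram $D$ by $X$ assigns an element of $X$ to each region so that the following holds at each crossing. Draw the crossing with both strands directed upward, let $a$ be the color of the left corner and $c$ the color of the right corner. At a positive crossing, let $b$ be the color of the bottom corner (adjacent to the two incoming edges) and $d$ the color of the top corner (adjacent to the two outgoing edges); at a negative crossing, let $b$ be the color of the top corner (adjacent to the outgoing edges) and $d$ the color of the bottom corner (adjacent to the incoming edges). In both cases it is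 required that $d=T(a,b,c)$. Colorings of $D$ and $D'$ agree on $F\setminus U$ if every point of $F\setminus U$ not on the diagram lies in regions of the same color for both. The chain assigned to a colored diagram is $c_D=\sum_\tau \epsilon_\tau (a,b,c)\in C_1(X)$, summed over all crossings $\tau$, where $\epsilon_\tau=+1$ for a positive and $-1$ for a negative crossing; it satisfies $\partial_1(c_D)=0$. Homology. For $n\ge -1$, $C_n(X)=\mathbb{Z}\langle X^{n+2}\rangle$ is the free abelian group on $(n+2)$-tuples $x=(x_0,\ldots,x_{n+1})$, and $C_{-2}(X)=\mathbb{Z}$. Set $\partial_{-1}(x_0)=0$, $\partial_0(x_0,x_1)=x_1-x_0$, and for $n>0$ $\partial_n x=\sum_{i=0}^n(-1)^i (d_i^{n,L}x-d_i^{n,R}x)$, where $d_i^{n,L}x=(d_{i,1}^{n,L}x,\ldots,d_{i,n+1}^{n,L}x)$ with $d_{i,k}^{n,L}x=x_k$ if $k>i$ and $d_{i,k}^{n,L}x=T(x_{k-1},x_k,d_{i,k+1}^{n,L}x)$ if $k\le i$; and $d_i^{n,R}x=(d_{i,0}^{n,R}x,\ldots,d_{i,n}^{n,R}x)$ with $d_{i,k}^{n,R}x=x_k$ if $k\le i$ and $d_{i,k}^{n,R}x=T(d_{i,k-1}^{n,R}x,x_k,x_{k+1})$ if $k>i$. This is a chain complex, with homology $H(X)$. For $n\ge 1$, $C_n^D(X)\subset C_n(X)$ is the subgroup generated by all $(n+2)$-tuples containing, on three consecutive coordinates, either $a,b,\mathcal{R}(a,b,b)$ or $\mathcal{L}(b,b,a),b,a$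 for some $a,b\in X$; for $n<1$, $C_n^D(X)=0$. This is a subcomplex, and $H^N(X)$ is the homology of the quotient complex $C_n(X)/C_n^D(X)$ with the induced differential. *)

(* Defs.v *)
From HB Require Import structures.
From mathcomp Require Import all_boot all_order all_algebra perm.
From mathcomp Require Import all_classical all_reals all_analysis.
From mathcomp Require Export freeg.

Set Implicit Arguments.
Unset Strict Implicit.
Unset Printing Implicit Defensive.

Import Order.TTheory GRing.Theory Num.Theory.
Import numFieldNormedType.Exports.
Local Open Scope classical_set_scope.
Local Open Scope ring_scope.

Definition is_ternary_quasigroup (X : Type) (T L M N : X -> X -> X -> X) : Prop :=
  forall x1 x2 x3,
  [/\ L (T x1 x2 x3) x2 x3 = x1 /\ T (L x1 x2 x3) x2 x3 = x1,
      M x1 (T x1 x2 x3) x3 = x2 /\ T x1 (M x1 x2 x3) x3 = x2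
    & N x1 x2 (T x1 x2 x3) = x3 /\ T x1 x2 (N x1 x2 x3) = x3].

Definition is_KTQ (X : Type) (T L M N : X -> X -> X -> X) : Prop :=
  [/\ is_ternary_quasigroup T L M N,
      forall a b c d,
        T (T a b c) c d = T (T a b (T b c d)) (T b c d) d
    & forall a b c d,
        T a b (T b c d) = T a (T a b c) (T (T a b c) c d)].

(* The index is a natural number: the groups in degrees -1 and -2 do not enter
   the homology in degree n >= 1. *)
Notation chains X n := {freeg (n.+2).-tuple X}.

Section Homology.
Context (X : choiceType) (T L N : X -> X -> X -> X).

Definition coord n (x : n.+2.-tuple X) (k : nat) : X := tnth x (inord k).

(* [dL_rec x i j] is d_{i,k}^L for k = i + 1 - j; the recursion on k is
   downward, from k = i + 1. *)
Fixpoint dL_rec (x : nat -> X) (i j : nat) : X :=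
  if j is j'.+1 then T (x (i - j').-1%N) (x (i - j')%N) (dL_rec x i j') else x i.+1.

Definition dL (x : nat -> X) (i k : nat) : X :=
  if (i < k)%N then x k else dL_rec x i (i.+1 - k)%N.

Fixpoint dR (x : nat -> X) (i k : nat) : X :=
  if k is k'.+1 then
    if (k <= i)%N then x k else T (dR x i k') (x k) (x k.+1)
  else x 0%N.

Definition faceL n (x : n.+2.-tuple X) (i : nat) : n.+1.-tuple X :=
  [tuple dL (coord x) i (val k).+1 | k < n.+1].
Definition faceR n (x : n.+2.-tuple X) (i : nat) : n.+1.-tuple X :=
  [tuple dR (coord x) i (val k) | k < n.+1].

Definition boundary_tuple n (x : n.+3.-tuple X) : chains X n :=
  \sum_(i < n.+2) (-1) ^+ i *: (<< faceL x i >> - << faceR x i >>).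

(* [boundary n] is the differential from degree n + 1 to degree n. *)
Definition boundary n : chains X n.+1 -> chains X n :=
  fglift (@boundary_tuple n).

Inductive generated (V : zmodType) (A : set V) : V -> Prop :=
| generated_in v of A v : generated A v
| generated0 : generated A 0
| generatedB v w of generated A v & generated A w : generated A (v - w).

Definition degenerate_tuple n (x : n.+2.-tuple X) : Prop :=
  exists (k : nat) (a b : X), (k.+2 < n.+2)%N /\
    ((coord x k, coord x k.+1, coord x k.+2) = (a, b, N a b b) \/
     (coord x k, coord x k.+1, coord x k.+2) = (L b b a, b, a)).

(* For n = 0 there is no degenerate tuple, and the subgroup is trivial. *)
Definition degenerate_chain n : chains X n -> Prop :=
  generated [set << x >> | x in @degenerate_tuple n].

(* Equality of classes in H_n(X), for cycles c and c'. *)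
Definition homologous n (c c' : chains X n) : Prop :=
  exists w : chains X n.+1, c - c' = boundary w.

(* Equality, in the homology of the quotient by degenerate chains, of the
   classes of the images of c and c'. *)
Definition homologousN n (c c' : chains X n) : Prop :=
  exists w : chains X n.+1, degenerate_chain (c - c' - boundary w).

End Homology.

Section Plane.
Context (R : realType).

Definition pt (a b : R) : 'rV[R]_2 := \row_j (if j == 0 then a else b).

(* Positive iff v lies counterclockwise from u (at an angle less than pi). *)
Definition det2 (u v : 'rV[R]_2) : R := u 0 0 * v 0 1 - u 0 1 * v 0 0.

Definition half_plane : set 'rV[R]_2 := [set x | 0 <= x 0 0].
Definition unit_disk : set 'rV[R]_2 := [set x | x 0 0 ^+ 2 + x 0 1 ^+ 2 <= 1].
Definition unit_circle : set 'rV[R]_2 := [set x | x 0 0 ^+ 2 + x 0 1 ^+ 2 = 1].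

End Plane.

Section Surface.
Context (R : realType) (F : topologicalType).

Record chart := Chart {
  chart_dom : set F;
  chart_map : F -> 'rV[R]_2;
  chart_inv : 'rV[R]_2 -> F }.

Definition chart_image (c : chart) : set 'rV[R]_2 := chart_map c @` chart_dom c.

(* A homeomorphism from an open set of F onto a relatively open subset of H. *)
Definition is_chart (H : set 'rV[R]_2) (c : chart) : Prop :=
  [/\ open (chart_dom c),
      exists2 O, open O & chart_image c = O `&` H,
      {in chart_dom c, cancel (chart_map c) (chart_inv c)},
      {within chart_dom c, continuous (chart_map c)}
    & {within chart_image c, continuous (chart_inv c)}].

(* The transition map is C^1 and orientation preserving. For charts modelled on
   the half plane, the condition concerns points away from the boundary. *)
Definition oriented_transition (c1 c2 : chart) : Prop :=
  forall x,
  (chart_map c1 @` (chart_dom c1 `&` chart_dom c2))° x ->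
  let f := chart_map c2 \o chart_inv c1 in
  [/\ differentiable f x, {for x, continuous (jacobian f)}
    & 0 < \det (jacobian f x)].

(* An oriented surface, possibly with boundary, given by an oriented atlas in
   which a chart is singled out around each point. *)
Record oriented_surface := OrientedSurface {
  chart_at : F -> chart;
  surface_hausdorff : hausdorff_space F;
  chart_atP : forall p, is_chart (@half_plane R) (chart_at p);
  mem_chart_at : forall p, chart_dom (chart_at p) p;
  chart_at_oriented : forall p q,
    oriented_transition (chart_at p) (chart_at q) }.

Context (S : oriented_surface).

Definition surface_boundary : set F :=
  [set p | exists2 q, chart_dom (chart_at S q) p
                    & chart_map (chart_at S q) p 0 0 = 0].

(* Oriented charts onto open subsets of the whole plane. *)
Definition plane_chart (c : chart) : Prop :=
  is_chart [set: 'rV[R]_2] c /\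
  forall q, oriented_transition c (chart_at S q) /\
            oriented_transition (chart_at S q) c.

Definition is_plane : Prop :=
  exists c, [/\ plane_chart c, chart_dom c = [set: F]
              & chart_image c = [set: 'rV[R]_2]].

(* Closed curves are parametrized by R with period 1. *)
Definition same_param n (i : 'I_n) (t : R) (j : 'I_n) (s : R) : Prop :=
  i = j /\ t - s \is a Num.int.

Definition double_param n (g : 'I_n -> R -> F) i t j s : Prop :=
  g i t = g j s /\ ~ same_param i t j s.

Definition velocity (c : chart) (g : R -> F) : R -> 'rV[R]_2 :=
  derive1 (chart_map c \o g).

(* An immersed collection of closed curves in the interior of the surface with
   finitely many multiple points, all of them transverse double points. The
   strand with parameter (i, t) passes over at a crossing iff [over i t]. *)
Record diagram := Diagram {
  ncurves : nat;
  curve : 'I_ncurves -> R -> F;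
  over : 'I_ncurves -> R -> bool;
  curve_periodic : forall i t, curve i (t + 1) = curve i t;
  curve_continuous : forall i, continuous (curve i);
  curve_interior : forall i t, ~ surface_boundary (curve i t);
  curve_immersed : forall i t q, chart_dom (chart_at S q) (curve i t) ->
    [/\ derivable (chart_map (chart_at S q) \o curve i) t 1,
        {for t, continuous (velocity (chart_at S q) (curve i))}
      & velocity (chart_at S q) (curve i) t != 0];
  curve_finite : finite_set
    [set p | exists i t j s, double_param curve i t j s /\ curve i t = p];
  curve_transverse : forall i t j s, double_param curve i t j s ->
    det2 (velocity (chart_at S (curve i t)) (curve i) t)
         (velocity (chart_at S (curve i t)) (curve j) s) != 0;
  curve_no_triple : forall i t j s k r,
    curve i t = curve j s -> curve j s = curve k r ->
    [\/ same_param i t j s, same_param j s k r | same_param i t k r];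
  over_periodic : forall i t, over i (t + 1) = over i t;
  over_double : forall i t j s, double_param curve i t j s ->
    over i t = ~~ over j s;
  over_only_double : forall i t, over i t ->
    exists j s, double_param curve i t j s }.

Arguments curve : clear implicits.
Arguments over : clear implicits.

Definition diagram_support (D : diagram) : set F :=
  [set p | exists i t, curve D i t = p].

Definition region (D : diagram) (p : F) : set F :=
  connected_component (~` diagram_support D) p.

(* Seen in the chart c, a strand of D with over-information o passes through
   the point x in the direction of the vector v. *)
Definition strand (D : diagram) (c : chart) (x v : 'rV[R]_2) (o : bool) : Prop :=
  exists i t (l : R),
  [/\ 0 < l, chart_dom c (curve D i t), chart_map c (curve D i t) = x,
      velocity c (curve D i) t = l *: v & over D i t = o].

Definition direction (D : diagram) (p : F) (o : bool) : 'rV[R]_2 :=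
  xget 0 [set v | strand D (chart_at S p) (chart_map (chart_at S p) p) v o].

Definition crossings (D : diagram) : set F :=
  [set p | exists i t, curve D i t = p /\ over D i t].

Definition positive (D : diagram) (p : F) : bool :=
  0 < det2 (direction D p true) (direction D p false).

Definition crossing_sign (D : diagram) (p : F) : int :=
  if positive D p then 1 else -1.

(* With both strands drawn upward, [heading_right] goes from the bottom left to
   the top right and [heading_left] from the bottom right to the top left. *)
Definition heading_right (D : diagram) (p : F) : 'rV[R]_2 :=
  direction D p (positive D p).
Definition heading_left (D : diagram) (p : F) : 'rV[R]_2 :=
  direction D p (~~ positive D p).

Context (X : choiceType).

(* A coloring is a function on regions; its values on the sets that are not
   regions of the diagram are irrelevant. *)
Implicit Types C : set F -> X.

(* The color of the corner at p into which the vector w points. The default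
   value is irrelevant. *)
Definition corner_color C (D : diagram) (p : F) (w : 'rV[R]_2) : X :=
  xget (C (region D p)) [set x | \forall s \near (0 : R)^'+,
    let q := chart_inv (chart_at S p) (chart_map (chart_at S p) p + s *: w) in
    C (region D q) = x].

Definition left_color C D p :=
  corner_color C D p (heading_left D p - heading_right D p).
Definition right_color C D p :=
  corner_color C D p (heading_right D p - heading_left D p).
Definition top_color C D p :=
  corner_color C D p (heading_right D p + heading_left D p).
Definition bottom_color C D p :=
  corner_color C D p (- (heading_right D p + heading_left D p)).

Definition color_a C D p := left_color C D p.
Definition color_b C D p :=
  if positive D p then bottom_color C D p else top_color C D p.
Definition color_c C D p := right_color C D p.
Definition color_d C D p :=
  if positive D p then top_color C D p else bottom_color C D p.

Definition is_coloring (T : X -> X -> X -> X) (D : diagram) C : Prop :=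
  forall p, crossings D p ->
  color_d C D p = T (color_a C D p) (color_b C D p) (color_c C D p).

Definition agree_off (U : set F) (D D' : diagram) C C' : Prop :=
  forall p, ~ U p -> ~ diagram_support D p -> ~ diagram_support D' p ->
  C (region D p) = C' (region D' p).

Definition diagram_chain (D : diagram) C : chains X 1 :=
  \sum_(p \in crossings D)
    << crossing_sign D p *g
       [tuple color_a C D p; color_b C D p; color_c C D p] >>.

End Surface.

Arguments curve {R F S} _ _ _.
Arguments over {R F S} _ _ _.

Section Reidemeister.
Context (R : realType).

(* A local picture in the unit disk: plane curves with heights, of which only
   the part inside the disk matters. *)
Record tangle := Tangle {
  narcs : nat;
  arc : 'I_narcs -> R -> 'rV[R]_2;
  height : 'I_narcs -> R -> R }.

Definition tangle_over (m : tangle) (k : 'I_(narcs m)) (t : R) : Prop :=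
  exists (k' : 'I_(narcs m)) (t' : R), arc k' t' = arc k t /\ height k' t' < height k t.

Definition tangle_strand (m : tangle) (x v : 'rV[R]_2) (o : bool) : Prop :=
  exists (k : 'I_(narcs m)) (t l : R),
  [/\ 0 < l, arc k t = x, derive1 (arc k) t = l *: v & (tangle_over k t <-> o)].

(* In the disk, a vertical chord, and a nodal cubic with the same end points
   (3/5, -4/5) and (3/5, 4/5) whose node is the origin; e is the direction and
   w tells which of the two passages through the node is the upper one. *)
Definition chord (e : bool) : tangle :=
  @Tangle 1 (fun _ t => pt (3 / 5) ((-1) ^+ e * t)) (fun _ _ => 0).
Definition kink (e w : bool) : tangle :=
  @Tangle 1
    (fun _ t0 => let t := (-1) ^+ e * t0 in
       pt ((t ^+ 2 - 1) / 5) (2 / 15 * (t ^+ 3 - t)))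
    (fun _ t0 => (-1) ^+ w * t0).

(* The graphs y = f k x for k < n; e k is the direction of the k-th graph and
   the permutation h is the order of the heights. *)
Definition graphs n (f : nat -> R -> R) (e : 'I_n -> bool) (h : 'S_n) : tangle :=
  @Tangle n
    (fun k t0 => let t := (-1) ^+ e k * t0 in pt t (f k t))
    (fun k _ => (h k : nat)%:R).

(* Both families end at (-4/5, 3/5), (4/5, 3/5) and (-4/5, -3/5), (4/5, -3/5);
   the second pair crosses at (-2/5, 0) and (2/5, 0). *)
Definition parallel_pair (k : nat) (x : R) : R := (-1) ^+ k * (3 / 5).
Definition crossed_pair (k : nat) (x : R) : R :=
  (-1) ^+ k * (5 / 4 * x ^+ 2 - 1 / 5).

(* Two lines crossing at the origin, and an arc from (-1, 0) to (1, 0) that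
   passes above the origin (s = false) or below it (s = true). *)
Definition triangle (s : bool) (k : nat) (x : R) : R :=
  nth 0 [:: 4 / 3 * x; - (4 / 3) * x; (-1) ^+ s * ((1 - x ^+ 2) / 2)] k.

Variant move_kind := RI | RII | RIII.

Variant local_move : move_kind -> tangle -> tangle -> Prop :=
| MoveI (e w : bool) : local_move RI (chord e) (kink e w)
| MoveII (e : 'I_2 -> bool) (h : 'S_2) :
    local_move RII (graphs parallel_pair e h) (graphs crossed_pair e h)
| MoveIII (e : 'I_3 -> bool) (h : 'S_3) :
    local_move RIII (graphs (triangle false) e h) (graphs (triangle true) e h).

Context (F : topologicalType) (S : oriented_surface R F).

Definition disk_chart (U : set F) (c : chart R F) : Prop :=
  [/\ plane_chart S c, @unit_disk R `<=` chart_image c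
    & U = chart_inv c @` @unit_disk R].

Definition looks_like (c : chart R F) (D : diagram S) (m : tangle) : Prop :=
  forall x v o, unit_disk x -> (strand D c x v o <-> tangle_strand m x v o).

(* U is a disk, D and D' coincide outside U, and their parts inside U are
   identified with the two sides of a local move by oriented parametrizations
   of U that agree on the boundary circle. Diagrams are compared as oriented
   curves with crossing information, regardless of parametrization. *)
Definition reidemeister_move (k : move_kind) (U : set F) (D D' : diagram S) :
    Prop :=
  exists (c c' : chart R F) (m m' : tangle),
  [/\ disk_chart U c /\ disk_chart U c',
      forall x, unit_circle x -> chart_inv c x = chart_inv c' x,
      local_move k m m' \/ local_move k m' m,
      looks_like c D m /\ looks_like c' D' m'
    & forall p v o, ~ U p ->
        (strand D (chart_at S p) (chart_map (chart_at S p) p) v o <->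
         strand D' (chart_at S p) (chart_map (chart_at S p) p) v o)].

End Reidemeister.

(* Main.v *)
Require Import Defs.
From mathcomp Require Import all_boot all_order all_algebra perm.
From mathcomp Require Import all_classical all_reals all_analysis.
From mathcomp Require Import ring lra.

(* At a crossing let a corner be described by the sides (left or right) of the
   upper and of the lower strand on which it lies. For both signs the rule
   d = T(a, b, c) becomes LR = T(LL, RL, RR), and the crossing contributes plus
   or minus (LL, RL, RR). The crossings outside the disk U contribute equally to
   both chains, so that only the local pictures matter.
   - RI: the loop has b = d at its crossing, so (a, b, c) is degenerate.
   - RII: the two crossings have opposite signs and share three corners, hence
     all four by the quasigroup property, and cancel.
   - RIII: the sides of the three strands (upper, middle, lower) index the
     vertices of a cube. Each diagram shows seven of them, six of which meet the
     boundary of U and get the same color in both. The six crossings are the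
     faces of the cube, and with signs they add up to the boundary of
     (LLL, RLL, RRL, RRR), up to sign. *)

Set Implicit Arguments.
Unset Strict Implicit.
Unset Printing Implicit Defensive.

Import Order.TTheory GRing.Theory Num.Theory.
Import numFieldNormedType.Exports.
Local Open Scope classical_set_scope.
Local Open Scope ring_scope.

(** * Regions near a point of a diagram *)

(** The obstacle is to read corner colors off the explicit pictures. Corner colors are defined along
    rays in the chart singled out at the crossing, while a picture lives in the chart of the disk.
    Under the transition map a ray becomes a curve of which only the tangent is known, so regions
    are controlled on a whole thin cone around each direction transverse to the strands. Directions
    of strands are determined only up to positive factors; a corner is therefore a combination of
    two directions with prescribed signs, and all combinations with the same signs must be shown to
    point into one region. For RIII each corner is joined by a segment to a point that depends only
    on the sides of the three graphs. Six of these points are put on the unit circle: it belongs to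
    [U], where nothing is assumed about the colorings, but agreement off [U] reaches it from
    outside. The two central sectors cannot be compared, but each occurs in one diagram only, so
    that every vertex of the cube still gets a single color. *)

Section PlaneVectors.
Context (R : realType).
Implicit Types u v w : 'rV[R]_2.

Lemma pt0 (a b : R) : pt a b 0 0 = a.
Proof. by rewrite mxE. Qed.

Lemma pt1 (a b : R) : pt a b 0 1 = b.
Proof. by rewrite mxE. Qed.

Lemma lift_ord2 : ((lift 0 0 : 'I_2) = 1) * ((lift 1 0 : 'I_2) = 0).
Proof. by split; apply: val_inj. Qed.

Lemma rV2P u v : u 0 0 = v 0 0 -> u 0 1 = v 0 1 -> u = v.
Proof.
move=> h0 h1; apply/rowP => i.
by case: (unliftP 0 i) => [j ->|-> //]; rewrite (ord1 j) lift_ord2.1.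
Qed.

Lemma det2Z a b u v : det2 (a *: u) (b *: v) = a * b * det2 u v.
Proof. by rewrite /det2 !mxE; ring. Qed.

Lemma sum_ord2 (f : 'I_2 -> R) : \sum_i f i = f 0 + f 1.
Proof. by rewrite big_ord_recl big_ord1 lift_ord2.1. Qed.

Lemma det_mx2 (J : 'M[R]_2) : \det J = J 0 0 * J 1 1 - J 0 1 * J 1 0.
Proof.
rewrite (expand_det_row _ 0) sum_ord2 /cofactor !det_mx11 !mxE lift_ord2.1 lift_ord2.2.
by rewrite /= addn0 add0n expr0 expr1 mul1r mulN1r mulrN.
Qed.

Lemma mulmx2 u (J : 'M[R]_2) i : (u *m J) 0 i = u 0 0 * J 0 i + u 0 1 * J 1 i.
Proof. by rewrite mxE sum_ord2. Qed.

Lemma det2_mulmx u v (J : 'M[R]_2) : det2 (u *m J) (v *m J) = det2 u v * \det J.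
Proof.
rewrite det_mx2 /det2 !mulmx2.
move: (u 0 0) (u 0 1) (v 0 0) (v 0 1) (J 0 0) (J 0 1) (J 1 0) (J 1 1) => *.
ring.
Qed.

Lemma cvg_det2 Z (G : set_system Z) {FG : Filter G} (f g : Z -> 'rV[R]_2) u v :
  f @ G --> u -> g @ G --> v -> (fun z => det2 (f z) (g z)) @ G --> det2 u v.
Proof.
move=> fu gv; rewrite /det2.
have cc (h : Z -> 'rV[R]_2) w : h @ G --> w -> forall i, (fun z => h z 0 i) @ G --> w 0 i.
  move=> hw i.
  by apply: (cvg_comp h (fun M : 'rV[R]_2 => M 0 i)); [exact: hw | exact: coord_continuous].
by apply: cvgB; apply: cvgM; apply: cc.
Qed.

End PlaneVectors.

(** * Keeping a family of points off a diagram *)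

Section Avoid.
Context (R : realType) (F : topologicalType) (S : oriented_surface R F).
Implicit Types D : diagram S.

Lemma curve_period D i t (n : int) : curve D i (t + n%:~R) = curve D i t.
Proof.
have H (m : nat) s : curve D i (s + m%:R) = curve D i s.
  by elim: m => [|m IH]; rewrite ?addr0 // -natr1 addrA curve_periodic.
case: n => n; first exact: H.
by rewrite NegzE rmorphN /= -[in RHS](subrK n.+1%:R t) H.
Qed.

Lemma same_param_shift n (i : 'I_n) t j s : same_param i t j s ->
  exists k : int, i = j /\ t = s + k%:~R :> R.
Proof. by move=> [-> /intrP[k hk]]; exists k; split=> //; rewrite -hk; ring. Qed.

Lemma supportP D p : diagram_support D p ->
  exists i, exists2 t, `[0, 1]%classic t & curve D i t = p.
Proof.
move=> [i [t <-]]; exists i; exists (t + (- Num.floor t)%:~R); last exact: curve_period.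
rewrite /= in_itv /= rmorphN /= subr_ge0 lerBlDr ge_floor /=.
by rewrite addrC; apply/ltW; have := floorD1_gt t; rewrite rmorphD.
Qed.

(** One period of each curve is compact and there are finitely many curves, so the local conditions
    at the parameters can be merged into one member of [G]. *)
Lemma avoid_near D Z (G : set_system Z) {FG : Filter G} (q : Z -> F) :
  (forall i (t : R), \forall t' \near t & z \near G, curve D i t' <> q z) ->
  \forall z \near G, ~ diagram_support D (q z).
Proof.
move=> H.
have cpt : compact (`[0, 1]%classic : set R) by exact: segment_compact.
move/compact_near_coveringP : cpt => cov.
have key : \forall z \near G, forall i : 'I_(ncurves D),
    (`[0, 1]%classic : set R) `<=` (fun t => curve D i t <> q z).
  by apply: filter_forall => i; apply: cov => t _; exact: H.
apply: filterS key => z Hz /supportP[i [t t01 E]].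
exact: (Hz i t t01).
Qed.

(** Separation settles every parameter whose point differs from the limit [p]; derivatives are
    needed only for the strands through [p]. *)
Lemma hausdorff_avoid D Z (G : set_system Z) {FG : Filter G} (q : Z -> F) p i (t : R) :
  q @ G --> p -> curve D i t <> p ->
  \forall t' \near t & z \near G, curve D i t' <> q z.
Proof.
move=> qp ne.
have hF := surface_hausdorff S; rewrite open_hausdorff in hF.
have /hF[[A B] /= [/set_mem At /set_mem Bp] [oA oB AB]] : curve D i t != p by apply/eqP.
have nA : \forall t' \near t, A (curve D i t').
  by apply: (@curve_continuous _ _ _ D i t); exact: open_nbhs_nbhs.
have nB : \forall z \near G, B (q z) by apply: qp; exact: open_nbhs_nbhs.
near=> t' z.
have At' : A (curve D i t') by near: t'.
have Bz : B (q z) by near: z.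
move=> E; have : (A `&` B) (q z) by split => //; rewrite -E.
by rewrite (eqP AB).
Unshelve. all: by end_near. Qed.

End Avoid.

(** * Charts, segments and thin cones *)

Section Charts.
Context (R : realType) (F : topologicalType) (S : oriented_surface R F).
Implicit Types (D : diagram S) (c : chart R F) (H : set 'rV[R]_2).

Lemma within_continuous_interior (T U : topologicalType) (A : set T) (f : T -> U) x :
  {within A, continuous f} -> A° x -> {for x, continuous f}.
Proof.
move=> cf Ax; have /subspace_continuousP/(_ x (interior_subset Ax)) := cf.
by rewrite (within_interior Ax).
Qed.

Lemma chart_invK c H y : is_chart H c -> chart_image c y ->
  chart_dom c (chart_inv c y) /\ chart_map c (chart_inv c y) = y.
Proof. by move=> [_ _ K _ _] [p dp <-]; rewrite K ?inE. Qed.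

Lemma chart_mapK c H p : is_chart H c -> chart_dom c p ->
  chart_inv c (chart_map c p) = p.
Proof. by move=> [_ _ K _ _] dp; rewrite K ?inE. Qed.

Lemma chart_inv_continuous c H y : is_chart H c -> (chart_image c)° y ->
  {for y, continuous (chart_inv c)}.
Proof. by move=> [_ _ _ _ ci] Iy; exact: (within_continuous_interior ci). Qed.

Lemma interior_chart_image c H p : is_chart H c -> chart_dom c p -> H° (chart_map c p) ->
  (chart_image c)° (chart_map c p).
Proof.
move=> [_ [V oV E] _ _ _] dp Hp; rewrite E interiorI; split => //.
apply: open_nbhs_nbhs; split=> //.
have : chart_image c (chart_map c p) by exists p.
by rewrite E => -[].
Qed.

Lemma plane_interior c y : is_chart [set: 'rV[R]_2] c -> chart_image c y -> (chart_image c)° y.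
Proof. by move=> [_ [V oV E] _ _ _]; rewrite E setIT => Vy; exact: open_nbhs_nbhs. Qed.

Lemma half_plane_interior (x : 'rV[R]_2) : half_plane x -> x 0 0 != 0 -> (@half_plane R)° x.
Proof.
rewrite /half_plane /= => x0 xn0; have xp : 0 < x 0 0 by rewrite lt_neqAle eq_sym xn0.
have h : \forall y \near x, 0 < (y : 'rV[R]_2) 0 0.
  exact: (cvgr_gt _ (@coord_continuous R 1 2 0 0 x)).
by apply: filterS h => y /ltW.
Qed.

(** Images of charts are open only relative to the half plane. Off the boundary of the surface the
    first coordinate is positive, and there they are open in the plane, so that every ray stays in
    the chart for a while. *)
Lemma chart_at_interior p : ~ surface_boundary S p ->
  (chart_image (chart_at S p))° (chart_map (chart_at S p) p).
Proof.
move=> nb; apply: (interior_chart_image (chart_atP S p)); first exact: mem_chart_at.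
have dp := mem_chart_at S p.
apply: half_plane_interior.
  have [_ [V oV E] _ _ _] := chart_atP S p.
  have : chart_image (chart_at S p) (chart_map (chart_at S p) p) by exists p.
  by rewrite E => -[].
by apply/eqP => h; apply: nb; exists p.
Qed.

Definition seg (y0 y1 : 'rV[R]_2) (l : R) : 'rV[R]_2 := y0 + l *: (y1 - y0).

Lemma seg0 y0 y1 : seg y0 y1 0 = y0. Proof. by rewrite /seg scale0r addr0. Qed.
Lemma seg1 y0 y1 : seg y0 y1 1 = y1. Proof. by rewrite /seg scale1r addrC subrK. Qed.

Lemma seg_continuous y0 y1 : continuous (seg y0 y1).
Proof.
move=> l; apply: cvgD; first exact: cvg_cst.
by apply: cvgZr_tmp; exact: cvg_id.
Qed.

Lemma segment_region D c H y0 y1 : is_chart H c ->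
  (forall l : R, 0 <= l <= 1 -> (chart_image c)° (seg y0 y1 l) /\
     ~ diagram_support D (chart_inv c (seg y0 y1 l))) ->
  region D (chart_inv c y0) = region D (chart_inv c y1).
Proof.
move=> hc h; apply: same_connected_component.
have con : connected ((chart_inv c \o seg y0 y1) @` `[0, 1]%classic).
  apply: connected_continuous_connected; first exact: segment_connected.
  apply: continuous_in_subspaceT => l /set_mem /= l01.
  apply: continuous_comp; first exact: seg_continuous.
  by apply: (chart_inv_continuous hc); case: (h l).
have e0 : (chart_inv c \o seg y0 y1) 0 = chart_inv c y0 by rewrite /= seg0.
have e1 : (chart_inv c \o seg y0 y1) 1 = chart_inv c y1 by rewrite /= seg1.
exists ((chart_inv c \o seg y0 y1) @` `[0, 1]%classic).
  split => //.
    by exists 0 => //=; rewrite in_itv /= lexx ler01.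
  by move=> _ [l /= l01 <-]; case: (h l).
by exists 1 => //=; rewrite in_itv /= lexx ler01.
Qed.


Lemma cvg_cone (x w : 'rV[R]_2) :
  (fun z : R * 'rV[R]_2 => x + z.1 *: z.2) @ filter_prod (0 : R)^'+ (nbhs w) --> x.
Proof.
rewrite -[X in _ --> X](_ : x + 0 *: w = x); last by rewrite scale0r addr0.
apply: cvgD; first exact: cvg_cst.
apply: cvgZ; last exact: cvg_snd.
by apply: cvg_trans cvg_fst _; exact: cvg_within.
Qed.

(* [w'] and the chord of the strand from [p] have a determinant close to
   [det2 w velocity], while a common point would make them collinear. *)
Lemma cone_avoid D c H p w : is_chart H c -> chart_dom c p ->
  (chart_image c)° (chart_map c p) ->
  (forall i t, curve D i t = p -> derivable (chart_map c \o curve D i) t 1 /\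
     det2 w (velocity c (curve D i) t) != 0) ->
  \forall s \near (0 : R)^'+ & w' \near w,
    (chart_image c)° (chart_map c p + s *: w') /\
    ~ diagram_support D (chart_inv c (chart_map c p + s *: w')).
Proof.
move=> hc dp ip trans.
set x := chart_map c p; set G := filter_prod (0 : R)^'+ (nbhs w).
have hx := @cvg_cone x w.
have inI : \forall z \near G, (chart_image c)° (x + z.1 *: z.2).
  by apply: hx; apply: open_nbhs_nbhs; split => //; exact: open_interior.
have invx : (fun z => chart_inv c (x + z.1 *: z.2)) @ G --> p.
  rewrite -[X in _ --> X](chart_mapK hc dp).
  by apply: (cvg_comp _ _ hx); exact: (chart_inv_continuous hc).
suff av : \forall z \near G, ~ diagram_support D (chart_inv c (x + z.1 *: z.2)).
  exact: filterI inI av.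
apply: avoid_near => i t.
have [Ep|ne] := pselect (curve D i t = p); last exact: hausdorff_avoid invx ne.
have [dg dn] := trans i t Ep.
set g := chart_map c \o curve D i.
have dom : \forall t' \near t, chart_dom c (curve D i t').
  apply: (@curve_continuous _ _ _ D i t); apply: open_nbhs_nbhs; rewrite Ep; split => //.
  by case: hc.
have [[A B] /= [nA nB] AB] : \forall h \near (0 : R)^' & w' \near w,
    det2 w' (h^-1 *: (g (h + t) - g t)) != 0.
  suff Q : (fun z : R * 'rV[R]_2 => det2 z.2 (z.1^-1 *: (g (z.1 + t) - g t)))
      @ filter_prod (0 : R)^' (nbhs w) --> det2 w (velocity c (curve D i) t).
    exact: (cvgr_neq0 _ Q dn).
  apply: cvg_det2; first exact: cvg_snd.
  apply: (cvg_comp fst (fun h : R => h^-1 *: (g (h + t) - g t))); first exact: cvg_fst.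
  have := dg; rewrite /derivable /=.
  rewrite (_ : (fun h => _) = fun h => h^-1 *: (g (h + t) - g t)) //.
  by apply: funext => h; rewrite /= [h%:A]mulr1.
have {}nA : \forall h \near (0 : R), h != 0 -> A h by exact: nA.
move: nA; rewrite (near_shift t) /= sub0r => nA.
near=> t' z => E.
have Iz : (chart_image c)° (x + z.1 *: z.2) by near: z.
have gt' : g t' = x + z.1 *: z.2.
  by rewrite /g /= E; case: (chart_invK hc (interior_subset Iz)).
have gt : g t = x by rewrite /g /= Ep.
have z0 : 0 < z.1.
  near: z; exists ([set s : R | 0 < s], setT) => /=; last by move=> [] /= ? ? [].
  by split; [exact: nbhs_right_gt | exact: filterT].
have Bz : B z.2.
  near: z; exists (setT, B) => /=; last by move=> [] /= ? ? [].
  by split; [exact: filterT |].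
have w'n0 : det2 z.2 (velocity c (curve D i) t) != 0.
  near: z.
  have Q : (fun z : R * 'rV[R]_2 => det2 z.2 (velocity c (curve D i) t)) @ G -->
      det2 w (velocity c (curve D i) t).
    by apply: cvg_det2; [exact: cvg_snd | exact: cvg_cst].
  exact: (cvgr_neq0 _ Q dn).
(* At [t' = t] there is no difference quotient, but then the point of the cone would be its apex,
   which forces [z.2 = 0] against transversality. *)
have [Et|nt] := eqVneq t' t.
  have : z.1 *: z.2 = 0 by apply: (addrI x); rewrite -gt' Et gt addr0.
  move/eqP; rewrite scaler_eq0 gt_eqF //= => /eqP zz.
  by move: w'n0; rewrite zz /det2 !mxE !mul0r subrr eqxx.
have At' : A (t' - t).
  have : (t' - t != 0 -> A (t' - t)) by near: t'; exact: nA.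
  by apply; rewrite subr_eq0.
have := AB (t' - t, z.2) (conj At' Bz); rewrite /= subrK gt' gt [x + _]addrC addrK.
by rewrite scalerA -[X in det2 X _]scale1r det2Z /det2 [_ 0 1 * _]mulrC subrr mulr0 eqxx.
Unshelve. all: by end_near. Qed.

(** A point of the cone is joined to the point of the axis at radius [d / 2] in two segments:
    turning towards [w] at constant [s], then moving along the axis. Both stay in the cone that
    avoids the diagram. *)
Lemma cone_region D c H p w : is_chart H c -> chart_dom c p ->
  (chart_image c)° (chart_map c p) ->
  (forall i t, curve D i t = p -> derivable (chart_map c \o curve D i) t 1 /\
     det2 w (velocity c (curve D i) t) != 0) ->
  exists r, \forall s \near (0 : R)^'+ & w' \near w,
    region D (chart_inv c (chart_map c p + s *: w')) = r.
Proof.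
move=> hc dp ip trans.
have [[A B] /= [nA nB] AB] := cone_avoid hc dp ip trans.
set x := chart_map c p.
have /nbhs_ballP[e /= e0 eB] := nB.
have [d /= d0 dA] := nA.
have inA s : 0 < s < d -> A s.
  by move=> /andP[s0 sd]; apply: dA => //=; rewrite sub0r normrN gtr0_norm.
have inB w' : `|w' - w| < e -> B w'.
  by move=> h; apply: eB; rewrite -ball_normE /= distrC.
exists (region D (chart_inv c (x + (d / 2) *: w))).
have cw l (v : 'rV[R]_2) : 0 <= l <= 1 -> `|v - w| < e -> `|seg v w l - w| < e.
  move=> /andP[l0 l1] vw.
  have -> : seg v w l - w = (1 - l) *: (v - w).
    by rewrite /seg; apply: rV2P; rewrite !mxE; ring.
  rewrite normrZ ger0_norm ?subr_ge0 //; apply: le_lt_trans vw.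
  by apply: ler_piMl => //; lra.
exists ([set s | 0 < s < d], [set w' | `|w' - w| < e]) => /=.
  split.
    near=> s; apply/andP; split; near: s; [exact: nbhs_right_gt | exact: nbhs_right_lt].
  by apply: filterS (nbhsx_ballx w e e0) => w'; rewrite -ball_normE /= distrC.
move=> [s w'] /= [sd w'e].
have s2 : 0 < d / 2 < d by lra.
transitivity (region D (chart_inv c (x + s *: w))).
  apply: (segment_region hc) => l l01.
  have -> : seg (x + s *: w') (x + s *: w) l = x + s *: seg w' w l.
    by rewrite /seg; apply: rV2P; rewrite !mxE; ring.
  by apply: (AB (s, seg w' w l)); split => /=; [exact: inA | apply: inB; exact: cw].
apply: (segment_region hc) => l l01.
have -> : seg (x + s *: w) (x + (d / 2) *: w) l = x + (s + l * (d / 2 - s)) *: w.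
  by rewrite /seg; apply: rV2P; rewrite !mxE; ring.
apply: (AB (s + l * (d / 2 - s), w)); split => /=; last first.
  by apply: inB; rewrite subrr normr0.
by apply: inA; nra.
Unshelve. all: by end_near. Qed.

(* Compactness of the segment of directions between [w0] and [w1] gives one
   radius at which the whole sector avoids the diagram. *)
Lemma sector_region D c H p w0 w1 : is_chart H c -> chart_dom c p ->
  (chart_image c)° (chart_map c p) ->
  (forall i t, curve D i t = p -> derivable (chart_map c \o curve D i) t 1 /\
     forall l : R, 0 <= l <= 1 -> det2 (seg w0 w1 l) (velocity c (curve D i) t) != 0) ->
  \forall s \near (0 : R)^'+,
    region D (chart_inv c (chart_map c p + s *: w0)) =
    region D (chart_inv c (chart_map c p + s *: w1)).
Proof.
move=> hc dp ip trans.
have cpt : compact (`[0, 1]%classic : set R) by exact: segment_compact.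
move/compact_near_coveringP : cpt => cov.
set x := chart_map c p.
have key : \forall s \near (0 : R)^'+, (`[0, 1]%classic : set R) `<=`
    (fun l => (chart_image c)° (x + s *: seg w0 w1 l) /\
      ~ diagram_support D (chart_inv c (x + s *: seg w0 w1 l))).
  apply: cov => l /= l01.
  have l01' : 0 <= l <= 1 by move: l01; rewrite in_itv.
  have [|[A B] /= [nA nB] AB] := @cone_avoid D c H p (seg w0 w1 l) hc dp ip.
    by move=> i t Ep; have [? /(_ l l01')] := trans i t Ep.
  near=> l' s.
  apply: (AB (s, seg w0 w1 l')); split => /=; first by near: s.
  by near: l'; exact: (seg_continuous nB).
apply: filterS key => s hs.
apply: (segment_region hc) => l l01.
have -> : seg (x + s *: w0) (x + s *: w1) l = x + s *: seg w0 w1 l.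
  by rewrite /seg; apply: rV2P; rewrite !mxE; ring.
by apply: hs; rewrite /= in_itv.
Unshelve. all: by end_near. Qed.

End Charts.

(** * Corner colors *)

Section Corners.
Context (R : realType) (F : topologicalType) (S : oriented_surface R F).
Implicit Types (D : diagram S) (c : chart R F) (u v w : 'rV[R]_2).

(** The filter of right neighbourhoods of 0 is proper, so the eventual color is unique and the
    default of [xget] does not show. *)
Lemma corner_colorP (X : choiceType) (C : set F -> X) D p w y :
  (\forall s \near (0 : R)^'+,
     C (region D (chart_inv (chart_at S p) (chart_map (chart_at S p) p + s *: w))) = y) ->
  corner_color C D p w = y.
Proof.
move=> h; apply: xget_unique => // y' h'.
have [s [<- <-]] := filter_ex (filterI h h').
by [].
Qed.

(** * Change of chart at a point of a diagram *)

Section Transition.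
Context (c : chart R F) (p : F).
Hypotheses (hc : plane_chart S c) (dp : chart_dom c p).
Hypothesis np : ~ surface_boundary S p.

Let q := chart_at S p.
Let phi := chart_map c \o chart_inv q.

(** [oriented_transition] speaks of interior points of the overlap. The point [p] is one, being off
    the boundary of the surface and in the open set [chart_dom c]. *)
Lemma transition_diff : differentiable phi (chart_map q p) /\
  0 < \det (jacobian phi (chart_map q p)).
Proof.
have [hc1 /(_ p)[_ /(_ (chart_map q p))]] := hc.
case=> //; have hq := chart_atP S p.
have Iq := chart_at_interior np.
have ci := chart_inv_continuous hq Iq.
have dn : nbhs (chart_map q p) (chart_inv q @^-1` chart_dom c).
  apply: ci; rewrite /= (chart_mapK hq (mem_chart_at S p)).
  by apply: open_nbhs_nbhs; split => //; case: hc1.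
apply: (filterS _ (filterI Iq dn)) => y [/= Iy dy].
have [h1 h2] := chart_invK hq Iy.
by exists (chart_inv q y).
Qed.

(** Immersion is part of a diagram only for the charts of the atlas; the chain rule carries it over
    to [c]. *)
Lemma velocity_transition D i t : curve D i t = p ->
  derivable (chart_map c \o curve D i) t 1 /\
  velocity c (curve D i) t =
    velocity q (curve D i) t *m jacobian phi (chart_map q p).
Proof.
move=> Ep; have hq := chart_atP S p.
have dq : chart_dom q (curve D i t) by rewrite Ep; exact: mem_chart_at.
have [der _ _] := curve_immersed dq.
have dphi := transition_diff.1.
have df : differentiable (chart_map q \o curve D i) t by exact/derivable1_diffP.
have ne : \forall t' \near t, (phi \o (chart_map q \o curve D i)) t' = (chart_map c \o curve D i) t'.
  have : \forall t' \near t, chart_dom q (curve D i t').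
    apply: (@curve_continuous _ _ _ D i t); apply: open_nbhs_nbhs; split => //.
    by case: hq.
  by apply: filterS => t' d'; rewrite /phi /= (chart_mapK hq d').
have dphi' : differentiable phi ((chart_map q \o curve D i) t) by rewrite /= Ep.
have dcomp := differentiable_comp df dphi'.
split; first by apply: near_eq_derivable ne _; exact/derivable1_diffP.
rewrite /velocity !derive1E -(near_eq_derive _ ne).
rewrite (deriveE _ dcomp) (diff_comp df dphi') /= (deriveE _ df) Ep.
by rewrite /jacobian mul_rV_lin1.
Qed.

(* The ray in the direction [w] of the chart at [p] is, in the chart [c],
   tangent to [w *m J], hence ends up in the thin cone around that direction. *)
Lemma transition_region D w r :
  (\forall s \near (0 : R)^'+ & w' \near w *m jacobian phi (chart_map q p),
    region D (chart_inv c (chart_map c p + s *: w')) = r) ->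
  \forall s \near (0 : R)^'+,
    region D (chart_inv q (chart_map q p + s *: w)) = r.
Proof.
move=> [[A B] /= [nA nB] AB].
have [dphi _] := transition_diff.
have hq := chart_atP S p.
have Iq := chart_at_interior np.
have ci := chart_inv_continuous hq Iq.
have Kp : chart_inv q (chart_map q p) = p by exact: chart_mapK hq (mem_chart_at S p).
set x := chart_map q p.
have hx : (fun s : R => x + s *: w) @ (0 : R)^'+ --> x.
  rewrite -[X in _ --> X](_ : x + 0 *: w = x); last by rewrite scale0r addr0.
  apply: cvgD; first exact: cvg_cst.
  apply: cvgZ; last exact: cvg_cst.
  by apply: cvg_within.
have dn : \forall s \near (0 : R)^'+, chart_dom c (chart_inv q (x + s *: w)).
  have := cvg_comp _ _ hx ci; apply; rewrite Kp.
  by apply: open_nbhs_nbhs; split => //; case: hc => -[].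
have quo : (fun s : R => s^-1 *: (phi (x + s *: w) - phi x)) @ (0 : R)^'+ -->
    w *m jacobian phi x.
  rewrite -(deriveEjacobian _ dphi).
  apply: cvg_dnbhs_at_right.
  have := @diff_derivable _ _ _ phi x w dphi; rewrite /derivable /derive.
  rewrite (_ : (fun h : R => _) = fun s : R => s^-1 *: (phi (x + s *: w) - phi x)) //.
  by apply: funext => s; rewrite /= [s *: w + x]addrC.
have nq := quo _ nB.
near=> s.
have s0 : 0 < s by near: s; exact: nbhs_right_gt.
have ds : chart_dom c (chart_inv q (x + s *: w)) by near: s.
rewrite -(chart_mapK hc.1 ds).
have -> : chart_map c (chart_inv q (x + s *: w)) =
    chart_map c p + s *: (s^-1 *: (phi (x + s *: w) - phi x)).
  rewrite scalerA divff ?gt_eqF // scale1r /phi /= Kp.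
  by rewrite subrKC.
apply: (AB (s, _)); split => /=; first by near: s.
by near: s.
Unshelve. all: by end_near. Qed.

End Transition.

Lemma strand_curve D c H p u o : is_chart H c -> chart_dom c p ->
  strand D c (chart_map c p) u o ->
  exists i t (l : R), [/\ 0 < l, curve D i t = p, velocity c (curve D i) t = l *: u & Defs.over D i t = o].
Proof.
move=> hc dp [i [t [l [l0 dt E vl ov]]]]; exists i, t, l; split => //.
by rewrite -(chart_mapK hc dt) E (chart_mapK hc dp).
Qed.

Lemma curve_strand D c i t : chart_dom c (curve D i t) ->
  strand D c (chart_map c (curve D i t)) (velocity c (curve D i) t) (Defs.over D i t).
Proof. by move=> dt; exists i, t, 1; split => //; rewrite scale1r. Qed.

(** The Jacobian of the transition sends the chosen directions to positive multiples of [u] and [v].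
    Its determinant is positive, which preserves the sign of the crossing, and the positive factors
    can be deformed to 1 without turning a corner direction across a strand. *)
Lemma crossing_in_chart D c p u v : plane_chart S c -> chart_dom c p ->
  strand D c (chart_map c p) u true -> strand D c (chart_map c p) v false ->
  (forall w o, strand D c (chart_map c p) w o ->
     exists2 l : R, 0 < l & w = l *: (if o then u else v)) ->
  det2 u v != 0 ->
  positive D p = (0 < det2 u v) /\
  forall (X : choiceType) (C : set F -> X) (a b : bool), \forall s \near (0 : R)^'+,
    corner_color C D p ((-1) ^+ a *: direction D p true + (-1) ^+ b *: direction D p false)
    = C (region D (chart_inv c (chart_map c p + s *: ((-1) ^+ a *: u + (-1) ^+ b *: v)))).
Proof.
move=> hc dp su sv all_uv duv.
have np : ~ surface_boundary S p.
  have [i [t [l [_ <- _ _]]]] := strand_curve hc.1 dp su.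
  exact: curve_interior.
have [dphi dJ] := transition_diff hc dp np.
set q := chart_at S p; set J := jacobian _ _ in dJ.
(* [direction] is an arbitrary choice on the half-line of the strand, hence the unknown factor
   [l]. *)
have hdir (o : bool) (z := if o then u else v) : strand D c (chart_map c p) z o ->
    exists2 l : R, 0 < l & direction D p o *m J = l *: z.
  move=> sz.
  have : strand D q (chart_map q p) (direction D p o) o.
    have [i [t [l [l0 Ep vl ov]]]] := strand_curve hc.1 dp sz.
    have := @curve_strand D q i t; rewrite Ep => /(_ (mem_chart_at S p)) h.
    apply: (@xgetPex _ 0 [set v | strand D q (chart_map q p) v o]).
    by exists (velocity q (curve D i) t); rewrite -ov.
  move=> /(strand_curve (chart_atP S p) (mem_chart_at S p)) [i [t [l [l0 Ep vl ov]]]].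
  have [_ vt] := velocity_transition hc dp np Ep.
  have := @curve_strand D c i t; rewrite Ep ov => /(_ dp) /all_uv[k k0 E].
  exists (l^-1 * k); first by rewrite mulr_gt0 ?invr_gt0.
  have := vt; rewrite E vl -scalemxAl -/J => E2.
  by rewrite -scalerA E2 scalerA mulVf ?gt_eqF // scale1r.
have [lu lu0 Eu] := hdir true su.
have [lv lv0 Ev] := hdir false sv.
split.
  rewrite /positive -(pmulr_lgt0 _ dJ) -det2_mulmx Eu Ev det2Z.
  by rewrite pmulr_rgt0 // mulr_gt0.
move=> X C a b.
set w0 := (-1) ^+ a *: direction D p true + (-1) ^+ b *: direction D p false.
set w1 := (-1) ^+ a *: u + (-1) ^+ b *: v.
have Ew0 : w0 *m J = ((-1) ^+ a * lu) *: u + ((-1) ^+ b * lv) *: v.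
  by rewrite mulmxDl -!scalemxAl Eu Ev !scalerA.
have ip : (chart_image c)° (chart_map c p).
  by apply: plane_interior hc.1 _; exists p.
(* Along the segment both coefficients keep their signs, so no vector on it is parallel to [u] or
   [v]. *)
have trans i t : curve D i t = p -> derivable (chart_map c \o curve D i) t 1 /\
     forall l : R, 0 <= l <= 1 -> det2 (seg (w0 *m J) w1 l) (velocity c (curve D i) t) != 0.
  move=> Ep; have [der _] := velocity_transition hc dp np Ep; split => // l l01.
  have := @curve_strand D c i t; rewrite Ep => /(_ dp) /all_uv[k k0 ->].
  have -> : seg (w0 *m J) w1 l = ((-1) ^+ a * ((1 - l) * lu + l)) *: u
      + ((-1) ^+ b * ((1 - l) * lv + l)) *: v.
    by rewrite Ew0 /seg /w1; apply: rV2P; rewrite !mxE; ring.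
  have hu : 0 < (1 - l) * lu + l by nra.
  have hv : 0 < (1 - l) * lv + l by nra.
  case: (Defs.over D i t).
    rewrite (_ : det2 _ _ = - ((-1) ^+ b * ((1 - l) * lv + l) * k * det2 u v)).
      by rewrite oppr_eq0 !mulf_neq0 ?signr_eq0 // gt_eqF.
    by rewrite /det2 !mxE; ring.
  rewrite (_ : det2 _ _ = ((-1) ^+ a * ((1 - l) * lu + l) * k * det2 u v)).
    by rewrite !mulf_neq0 ?signr_eq0 // gt_eqF.
  by rewrite /det2 !mxE; ring.
have [r hr] : exists r, \forall s \near (0 : R)^'+ & w' \near w0 *m J,
    region D (chart_inv c (chart_map c p + s *: w')) = r.
  apply: (cone_region hc.1 dp ip) => i t Ep; have [der h] := trans i t Ep.
  by split => //; have := h 0; rewrite seg0 lexx ler01; apply.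
rewrite (@corner_colorP _ C D p w0 (C r)); last first.
  by apply: filterS (transition_region hc dp np hr) => s ->.
have hs : \forall s \near (0 : R)^'+, region D (chart_inv c (chart_map c p + s *: (w0 *m J))) = r.
  case: hr => -[A B] /= [nA nB] AB; near=> s; apply: (AB (s, _)).
  by split => /=; [near: s | exact: nbhs_singleton].
have h2 := sector_region hc.1 dp ip trans.
by apply: (filterS _ (filterI hs h2)) => s [<- <-].
Unshelve. all: by end_near. Qed.

End Corners.

(** * Crossings outside the disk *)

Section Outside.
Context (R : realType) (F : topologicalType) (S : oriented_surface R F).
Implicit Types (D : diagram S) (c : chart R F) (u v w : 'rV[R]_2).

Lemma over_period D i t (n : int) : Defs.over D i (t + n%:~R) = Defs.over D i t.
Proof.
have H (m : nat) s : Defs.over D i (s + m%:R) = Defs.over D i s.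
  by elim: m => [|m IH]; rewrite ?addr0 // -natr1 addrA over_periodic.
case: n => n; first exact: H.
by rewrite NegzE rmorphN /= -[in RHS](subrK n.+1%:R t) H.
Qed.

Lemma velocity_period D c i t (n : int) :
  velocity c (curve D i) (t + n%:~R) = velocity c (curve D i) t.
Proof.
rewrite /velocity /derive1 /= curve_period.
rewrite (_ : (fun h : R => _) =
  fun h => h^-1 *: (chart_map c (curve D i (h + t)) - chart_map c (curve D i t))) //.
by apply: funext => h; rewrite addrA curve_period.
Qed.

(** Two passages through [p] with the same over-information cannot form a double point by
    [over_double]; their parameters differ by an integer and their velocities are equal. The upper
    and the lower passage do form one, whence the determinant. *)
Lemma crossing_directions D p (q := chart_at S p) : crossings D p ->
  [/\ strand D q (chart_map q p) (direction D p true) true,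
      strand D q (chart_map q p) (direction D p false) false,
      (forall w o, strand D q (chart_map q p) w o ->
        exists2 l : R, 0 < l & w = l *: direction D p o)
    & det2 (direction D p true) (direction D p false) != 0].
Proof.
move=> [i0 [t0 [E0 o0]]].
have [j0 [s0 d0]] := over_only_double o0.
have o1 : Defs.over D j0 s0 = false.
  by have := over_double d0; rewrite o0; case: (Defs.over D j0 s0).
have hq := chart_atP S p; have dq := mem_chart_at S p.
have dirP (o : bool) i t : curve D i t = p -> Defs.over D i t = o ->
    strand D q (chart_map q p) (direction D p o) o.
  move=> Ep ov; apply: (@xgetPex _ 0 [set v | strand D q (chart_map q p) v o]).
  exists (velocity q (curve D i) t); have := @curve_strand _ _ _ D q i t.
  by rewrite Ep ov; apply.
have sT := dirP true _ _ E0 o0.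
have sF : strand D q (chart_map q p) (direction D p false) false.
  by apply: dirP o1; rewrite -E0; case: d0.
split => //.
  move=> w o /(strand_curve hq dq)[i [t [l [l0 Ep vl ov]]]].
  have : strand D q (chart_map q p) (direction D p o) o by case: o {ov}.
  move=> /(strand_curve hq dq)[i' [t' [l' [l'0 Ep' vl' ov']]]].
  have : same_param i t i' t'.
    apply: contrapT => nsp; have : double_param (curve D) i t i' t'.
      by split => //; rewrite Ep Ep'.
    by move=> /over_double; rewrite ov ov'; case: (o).
  move=> /same_param_shift[k [Ei Et]]; rewrite -Ei in vl'.
  exists (l^-1 * l'); first by rewrite mulr_gt0 ?invr_gt0.
  rewrite -scalerA -vl' -(velocity_period q i t' k) -Et vl scalerA mulVf ?gt_eqF //.
  by rewrite scale1r.
have [i [t [l [l0 Ep vl ov]]]] := strand_curve hq dq sT.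
have [j [s [l' [l'0 Ep' vl' ov']]]] := strand_curve hq dq sF.
have : double_param (curve D) i t j s.
  split; first by rewrite Ep Ep'.
  move=> /same_param_shift[k [Ei Et]].
  by move: ov; rewrite Ei Et over_period ov'.
move=> /curve_transverse; rewrite Ep -/q vl vl' det2Z.
by apply: contra_neq => ->; rewrite mulr0.
Qed.

Definition crossing_term (X : choiceType) (C : set F -> X) D p : {freeg 3.-tuple X} :=
  << crossing_sign D p *g [tuple color_a C D p; color_b C D p; color_c C D p] >>.

Lemma near_ray w (P : R -> 'rV[R]_2 -> Prop) :
  (\forall s \near (0 : R)^'+ & w' \near w, P s w') ->
  \forall s \near (0 : R)^'+, P s w.
Proof.
case=> -[A B] /= [nA nB] AB; near=> s; apply: (AB (s, w)).
by split => /=; [near: s; exact: nA | exact: nbhs_singleton].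
Unshelve. all: by end_near. Qed.

(** Since [U] is closed, the points close to [p] on the ray are off [U] and off both diagrams, where
    colors can be compared. The regions themselves may differ as sets. *)
Lemma corner_color_agree (X : choiceType) (C C' : set F -> X) U D D' p w :
  closed U -> agree_off U D D' C C' -> ~ U p ->
  ~ surface_boundary S p ->
  (forall i t, curve D i t = p -> det2 w (velocity (chart_at S p) (curve D i) t) != 0) ->
  (forall i t, curve D' i t = p -> det2 w (velocity (chart_at S p) (curve D' i) t) != 0) ->
  corner_color C D p w = corner_color C' D' p w.
Proof.
move=> cU agr nU np tD tD'.
set q := chart_at S p; have hq := chart_atP S p; have dq := mem_chart_at S p.
have ip := chart_at_interior np.
have der D0 i t : curve D0 i t = p -> derivable (chart_map q \o curve D0 i) t 1.
  move=> Ep; have dt : chart_dom q (curve D0 i t) by rewrite Ep.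
  by case: (curve_immersed dt) => h _ _; exact: h.
have hD i t (Ep : curve D i t = p) := conj (der D i t Ep) (tD i t Ep).
have hD' i t (Ep : curve D' i t = p) := conj (der D' i t Ep) (tD' i t Ep).
have av := cone_avoid hq dq ip hD; have av' := cone_avoid hq dq ip hD'.
have [r hr] := cone_region hq dq ip hD; have [r' hr'] := cone_region hq dq ip hD'.
have {}av := near_ray av; have {}av' := near_ray av'.
have {}hr := near_ray hr; have {}hr' := near_ray hr'.
rewrite (@corner_colorP _ _ _ _ C D p w (C r)); last by apply: filterS hr => s /= ->.
rewrite (@corner_colorP _ _ _ _ C' D' p w (C' r')); last by apply: filterS hr' => s /= ->.
have nUs : \forall s \near (0 : R)^'+, ~ U (chart_inv q (chart_map q p + s *: w)).
  have : nbhs p (~` U) by apply: open_nbhs_nbhs; split => //; rewrite openC.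
  rewrite -[X in nbhs X](chart_mapK hq dq) => /(chart_inv_continuous hq ip).
  move=> nV; have := @cvg_cone _ (chart_map q p) w _ nV.
  exact: (@near_ray w (fun s w' => ~ U (chart_inv q (chart_map q p + s *: w')))).
near ((0 : R)^'+) => s.
rewrite (_ : r = region D (chart_inv q (chart_map q p + s *: w))); last by near: s; apply: filterS hr => s /= ->.
rewrite (_ : r' = region D' (chart_inv q (chart_map q p + s *: w))); last by near: s; apply: filterS hr' => s /= ->.
apply: agr; near: s => //; by [apply: filterS av => s [] | apply: filterS av' => s []].
Unshelve. all: by end_near. Qed.

Lemma crossings_agree U D D' :
  (forall p v o, ~ U p ->
        (strand D (chart_at S p) (chart_map (chart_at S p) p) v o <->
         strand D' (chart_at S p) (chart_map (chart_at S p) p) v o)) ->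
  crossings D `&` ~` U `<=` crossings D' `&` ~` U.
Proof.
move=> h p [/crossing_directions[sT _ _ _] nU]; split => //.
have := sT; rewrite h // => /(strand_curve (chart_atP S p) (mem_chart_at S p)).
by move=> [i [t [l [_ Ep _ ov]]]]; exists i, t.
Qed.

Lemma crossing_term_agree (X : choiceType) (C C' : set F -> X) U D D' p :
  closed U -> agree_off U D D' C C' ->
  (forall p v o, ~ U p ->
        (strand D (chart_at S p) (chart_map (chart_at S p) p) v o <->
         strand D' (chart_at S p) (chart_map (chart_at S p) p) v o)) ->
  crossings D p -> ~ U p -> crossing_term C D p = crossing_term C' D' p.
Proof.
move=> cU agr h cp nU.
(* Both choices are made by [xget] from the same set of vectors, so they are equal and not just
   proportional. *)
have Ed o : direction D p o = direction D' p o.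
  rewrite /direction; congr xget; apply/seteqP.
  by split => v /=; rewrite h.
have Epos : positive D p = positive D' p by rewrite /positive !Ed.
have [cp' _] := crossings_agree h (conj cp nU).
have [i0 [t0 [E0 _]]] := cp.
have np : ~ surface_boundary S p by rewrite -E0; exact: curve_interior.
have cc (a b : bool) w : w = (-1) ^+ a *: direction D p true + (-1) ^+ b *: direction D p false ->
    corner_color C D p w = corner_color C' D' p w.
  move=> ->.
  have trans D0 : crossings D0 p -> (forall o, direction D p o = direction D0 p o) ->
      forall i t, curve D0 i t = p -> det2
        ((-1) ^+ a *: direction D p true + (-1) ^+ b *: direction D p false)
        (velocity (chart_at S p) (curve D0 i) t) != 0.
    move=> /crossing_directions[_ _ all_d dn] E i t Ep.
    have := @curve_strand _ _ _ D0 (chart_at S p) i t.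
    rewrite Ep => /(_ (mem_chart_at S p)) /all_d[l l0 ->]; rewrite !E.
    case: (Defs.over D0 i t).
      rewrite (_ : det2 _ _ = - ((-1) ^+ b * l * det2 (direction D0 p true) (direction D0 p false))).
        by rewrite oppr_eq0 !mulf_neq0 ?signr_eq0 // gt_eqF.
      by rewrite /det2 !mxE; ring.
    rewrite (_ : det2 _ _ = ((-1) ^+ a * l * det2 (direction D0 p true) (direction D0 p false))).
      by rewrite !mulf_neq0 ?signr_eq0 // gt_eqF.
    by rewrite /det2 !mxE; ring.
  by apply: corner_color_agree nU np (trans D cp _) (trans D' cp' _).
have Es : crossing_sign D p = crossing_sign D' p by rewrite /crossing_sign Epos.
rewrite /crossing_term Es /color_a /color_b /color_c /left_color /right_color
  /bottom_color /top_color /heading_left /heading_right -!Ed -Epos.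
have e1 : direction D p true - direction D p false =
  (-1) ^+ false *: direction D p true + (-1) ^+ true *: direction D p false.
  by rewrite expr0 expr1 scale1r scaleN1r.
have e2 : direction D p false - direction D p true =
  (-1) ^+ true *: direction D p true + (-1) ^+ false *: direction D p false.
  by rewrite expr0 expr1 scale1r scaleN1r addrC.
have e3 : direction D p false + direction D p true =
  (-1) ^+ false *: direction D p true + (-1) ^+ false *: direction D p false.
  by rewrite expr0 !scale1r addrC.
have e4 : - (direction D p true + direction D p false) =
  (-1) ^+ true *: direction D p true + (-1) ^+ true *: direction D p false.
  by rewrite expr1 !scaleN1r opprD.
by case: (positive D p) => /=; rewrite (cc _ _ _ e1) (cc _ _ _ e2) ?(cc _ _ _ e3) ?(cc _ _ _ e4).
Qed.

Lemma finite_crossings D : finite_set (crossings D).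
Proof.
apply: sub_finite_set (curve_finite D) => p [i [t [Ep ov]]].
by have [j [s d]] := over_only_double ov; exists i, t, j, s.
Qed.

Definition inner_chain (X : choiceType) (C : set F -> X) U D : {freeg 3.-tuple X} :=
  \sum_(p \in crossings D `&` U) crossing_term C D p.

Lemma chain_diff (X : choiceType) (C C' : set F -> X) U D D' :
  closed U -> agree_off U D D' C C' ->
  (forall p v o, ~ U p ->
        (strand D (chart_at S p) (chart_map (chart_at S p) p) v o <->
         strand D' (chart_at S p) (chart_map (chart_at S p) p) v o)) ->
  diagram_chain D C - diagram_chain D' C' = inner_chain C U D - inner_chain C' U D'.
Proof.
move=> cU agr h.
change (diagram_chain D C) with (\sum_(p \in crossings D) crossing_term C D p).
change (diagram_chain D' C') with (\sum_(p \in crossings D') crossing_term C' D' p).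
rewrite (fsbigID U _ _ (finite_crossings D)) /=.
rewrite [X in _ - X](fsbigID U _ _ (finite_crossings D')) /=.
rewrite (_ : crossings D' `&` ~` U = crossings D `&` ~` U); last first.
  by apply/seteqP; split; apply: crossings_agree => p v o nU; rewrite h.
rewrite /inner_chain.
rewrite [X in _ - (_ + X)](eq_fsbigr (crossing_term C D)); last first.
  by move=> p /set_mem[cp nU]; rewrite -(crossing_term_agree cU agr h cp nU).
by rewrite opprD addrACA subrr addr0.
Qed.

End Outside.

(** * Local pictures *)

Section Disk.
Context (R : realType).
Implicit Types z : 'rV[R]_2.

Lemma unit_disk_compact : compact (@unit_disk R).
Proof.
apply: bounded_closed_compact.
  exists 1; split => // M M1 z /= dz; apply: le_trans (ltW M1).
  rewrite [leLHS]/Num.Def.normr /= mx_normrE; apply: bigmax_le => // -[i j] _ /=.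
  rewrite (ord1 i) -(@ler_pXn2r _ 2) ?nnegrE // expr1n real_normK ?num_real //.
  apply: le_trans dz; case: (unliftP 0 j) => [k ->|->].
    by rewrite (ord1 k) lift_ord2.1 lerDr sqr_ge0.
  by rewrite lerDl sqr_ge0.
rewrite (_ : @unit_disk R = (fun z : 'rV[R]_2 => z 0 0 * z 0 0 + z 0 1 * z 0 1) @^-1` [set x | x <= 1]); last first.
  by apply/seteqP; split=> z; rewrite /unit_disk /= !expr2.
apply: preimage_closed; last exact: closed_le.
move=> z _.
have H Z (G : set_system Z) (FG : Filter G) (f : Z -> 'rV[R]_2) (u : 'rV[R]_2) : f @ G --> u ->
    (fun t => f t 0 0 * f t 0 0 + f t 0 1 * f t 0 1) @ G --> u 0 0 * u 0 0 + u 0 1 * u 0 1.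
  move=> fu; have cc i : (fun t => f t 0 i) @ G --> u 0 i.
    exact: (cvg_comp f (fun M : 'rV[R]_2 => M 0 i) fu (@coord_continuous R 1 2 0 i u)).
  by apply: cvgD; apply: cvgM.
exact: (H _ _ (nbhs_filter z) id z cvg_id).
Qed.

Lemma unit_disk_seg z0 z1 (l : R) : 0 <= l <= 1 -> unit_disk z0 -> unit_disk z1 ->
  unit_disk (seg z0 z1 l).
Proof.
rewrite /unit_disk /seg /= !mxE.
move: (z0 0 0) (z0 0 1) (z1 0 0) (z1 0 1) => x y x' y' /andP[l0 l1] h h'.
rewrite (_ : _ + _ = (1 - l) * (x ^+ 2 + y ^+ 2) + l * (x' ^+ 2 + y' ^+ 2)
   - l * (1 - l) * ((x - x') ^+ 2 + (y - y') ^+ 2)); last by ring.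
have h1 : 0 <= l * (1 - l) * ((x - x') ^+ 2 + (y - y') ^+ 2).
  by rewrite !mulr_ge0 ?subr_ge0 // addr_ge0 ?sqr_ge0.
have : (1 - l) * (x ^+ 2 + y ^+ 2) <= (1 - l) * 1 by rewrite ler_wpM2l ?subr_ge0.
have : l * (x' ^+ 2 + y' ^+ 2) <= l * 1 by rewrite ler_wpM2l.
lra.
Qed.

Lemma derive1_pt (a b : R -> R) (a' b' t : R) :
  is_derive t 1 a a' -> is_derive t 1 b b' ->
  derive1 (fun s => pt (a s) (b s)) t = pt a' b'.
Proof.
move=> da db.
have dm : derivable (fun s => pt (a s) (b s)) t 1.
  apply/derivable_mxP => i j; rewrite (ord1 i); case: (unliftP 0 j) => [k ->|->].
    rewrite (ord1 k) lift_ord2.1.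
    by under eq_fun do rewrite pt1; exact: ex_derive.
  by under eq_fun do rewrite pt0; exact: ex_derive.
rewrite derive1E derive_mx //; apply: rV2P; rewrite [LHS]mxE ?pt0 ?pt1.
  by under eq_fun do rewrite pt0; exact: derive_val.
by under eq_fun do rewrite pt1; exact: derive_val.
Qed.

End Disk.

(** * Diagrams seen in the chart of a disk *)

Section DiskChart.
Context (R : realType) (F : topologicalType) (S : oriented_surface R F).
Implicit Types (D : diagram S) (c : chart R F) (u v w z : 'rV[R]_2).

Section OneDisk.
Context (U : set F) (c : chart R F) (hU : disk_chart S U c).

Let hc : plane_chart S c. Proof. by case: hU. Qed.

Lemma disk_interior z : unit_disk z -> (chart_image c)° z.
Proof. by case: hU => _ sub _ dz; apply: (plane_interior hc.1); exact: sub. Qed.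

Lemma disk_inv z : unit_disk z ->
  [/\ chart_dom c (chart_inv c z), chart_map c (chart_inv c z) = z & U (chart_inv c z)].
Proof.
case: hU => _ sub -> dz; have [h1 h2] := chart_invK hc.1 (sub _ dz).
by split => //; exists z.
Qed.

Lemma disk_closed : closed U.
Proof.
case: (hU) => _ sub ->; apply: (compact_closed (surface_hausdorff S)).
apply: continuous_compact; last exact: unit_disk_compact.
apply: continuous_in_subspaceT => z /set_mem dz.
exact: (chart_inv_continuous hc.1 (disk_interior dz)).
Qed.

Lemma disk_mem p : U p -> exists2 z, unit_disk z & p = chart_inv c z.
Proof. by case: hU => _ _ -> [z dz <-]; exists z. Qed.

Lemma disk_inj_out z : chart_image c z -> ~ unit_disk z -> ~ U (chart_inv c z).
Proof.
move=> iz nz /disk_mem[z' dz' E]; apply: nz.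
have [_ <-] := chart_invK hc.1 iz.
by rewrite E; have [_ -> _] := disk_inv dz'.
Qed.

Lemma disk_support D m z : looks_like c D m -> unit_disk z ->
  diagram_support D (chart_inv c z) -> exists (k : 'I_(narcs m)) t, Defs.arc k t = z.
Proof.
move=> hl dz [i [t E]]; have [d E' _] := disk_inv dz.
have := @curve_strand _ _ _ D c i t; rewrite E E' => /(_ d) /hl.
by move=> /(_ dz) [k [s [l [_ h _ _]]]]; exists k, s.
Qed.

Lemma disk_segment_region D m z0 z1 : looks_like c D m ->
  (forall l : R, 0 <= l <= 1 -> unit_disk (seg z0 z1 l) /\
     forall (k : 'I_(narcs m)) t, Defs.arc k t <> seg z0 z1 l) ->
  region D (chart_inv c z0) = region D (chart_inv c z1).
Proof.
move=> hl h; apply: (segment_region hc.1) => l /h[dl nl]; split.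
  exact: disk_interior.
by move=> /(disk_support hl dl)[k [t /nl]].
Qed.

(* Just outside the circle the colorings agree, and the diagrams do not come
   close to [chart_inv c z]. *)
Lemma circle_color (X : choiceType) (C C' : set F -> X) D D' z :
  agree_off U D D' C C' -> unit_circle z ->
  ~ diagram_support D (chart_inv c z) -> ~ diagram_support D' (chart_inv c z) ->
  C (region D (chart_inv c z)) = C' (region D' (chart_inv c z)).
Proof.
move=> agr cz nD nD'.
have dz : unit_disk z by rewrite /unit_disk /= cz.
have iz := disk_interior dz.
have ci := chart_inv_continuous hc.1 iz.
have hs : (fun s : R => z + s *: z) @ (0 : R) --> z.
  rewrite -[X in _ --> X](_ : z + 0 *: z = z); last by rewrite scale0r addr0.
  by apply: cvgD; [exact: cvg_cst | apply: cvgZ; [exact: cvg_id | exact: cvg_cst]].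
have hi : (fun s : R => chart_inv c (z + s *: z)) @ (0 : R) --> chart_inv c z.
  exact: (cvg_comp _ _ hs ci).
have av D0 : ~ diagram_support D0 (chart_inv c z) ->
    \forall s \near (0 : R), ~ diagram_support D0 (chart_inv c (z + s *: z)).
  move=> n0; apply: (@avoid_near _ _ _ D0 _ (nbhs (0 : R)) _ (fun s => chart_inv c (z + s *: z))) => i t.
  by apply: (hausdorff_avoid hi) => E; apply: n0; exists i, t.
have nI : \forall s \near (0 : R), (chart_image c)° (z + s *: z).
  by apply: hs; apply: open_nbhs_nbhs; split => //; exact: open_interior.
(* A full neighbourhood of 0 is used, not a right one, because the radial segment starts at [z]
   itself, that is at [s = 0]. *)
have [e /= e0 h] : nbhs (0 : R) [set s | (chart_image c)° (z + s *: z) /\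
    ~ diagram_support D (chart_inv c (z + s *: z)) /\
    ~ diagram_support D' (chart_inv c (z + s *: z))].
  near=> s; split; [by near: s|split]; near: s; exact: av.
have {}h s : 0 <= s < e -> (chart_image c)° (z + s *: z) /\
    ~ diagram_support D (chart_inv c (z + s *: z)) /\
    ~ diagram_support D' (chart_inv c (z + s *: z)).
  by move=> /andP[s0 se]; apply: h; rewrite /= sub0r normrN ger0_norm.
have reg D0 : (forall s, 0 <= s < e -> ~ diagram_support D0 (chart_inv c (z + s *: z))) ->
    region D0 (chart_inv c z) = region D0 (chart_inv c (z + (e / 2) *: z)).
  move=> n0; apply: (segment_region hc.1) => l /andP[l0 l1].
  have -> : seg z (z + (e / 2) *: z) l = z + (l * (e / 2)) *: z.
    by rewrite /seg; apply: rV2P; rewrite !mxE; ring.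
  have hle : 0 <= l * (e / 2) < e by nra.
  by split; [case: (h _ hle) | exact: n0].
have he : 0 <= e / 2 < e by lra.
have [hI [hD hD']] := h _ he.
rewrite (reg D); last by move=> s /h[_ []].
rewrite (reg D'); last by move=> s /h[_ []].
apply: agr => //; apply: disk_inj_out; first exact: interior_subset.
rewrite /unit_disk /= !mxE => le1.
have : (1 + e / 2) ^+ 2 <= 1.
  rewrite -[X in X <= _]mulr1 -[X in _ * X <= _]cz; apply: le_trans le1.
  by rewrite le_eqVlt; apply/orP; left; apply/eqP; ring.
nra.
Unshelve. all: by end_near. Qed.

Lemma disk_crossings D m : looks_like c D m ->
  crossings D `&` U = chart_inv c @` [set z | unit_disk z /\ exists v, tangle_strand m z v true].
Proof.
move=> hl; apply/seteqP; split => [p [[i [t [Ep ov]]] /disk_mem[z dz E]]|_ [z [dz [v hv]] <-]].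
  exists z => //; split => //.
  have [d Ez _] := disk_inv dz.
  exists (velocity c (curve D i) t); apply/hl => //.
  have := @curve_strand _ _ _ D c i t; rewrite Ep E Ez ov; exact.
have [d Ez hz] := disk_inv dz; split => //.
have := hv; rewrite -hl // -[X in strand _ _ X _ _]Ez => /(strand_curve hc.1 d).
by move=> [i [t [l [_ Ep _ ov]]]]; exists i, t.
Qed.

(* [x] and [y] tell whether the corner is on the right of the over and of the
   under strand; for both signs of the crossing the coloring rule then reads
   LR = T(LL, RL, RR). *)
Definition side_color (X : choiceType) (C : set F -> X) D p (x y : bool) : X :=
  if y then (if x then color_c C D p else color_d C D p)
  else (if x then color_b C D p else color_a C D p).

(** If [det2 u v] is positive, [v] points to the left of [u] and [u] to the right of [v]. Thus the
    side of the over strand fixes the sign of [v] and the side of the under strand that of [u]; at a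
    negative crossing [n] reverses both. *)
Lemma disk_crossing D m z u v : looks_like c D m -> unit_disk z ->
  tangle_strand m z u true -> tangle_strand m z v false ->
  (forall w o, tangle_strand m z w o ->
     exists2 l : R, 0 < l & w = l *: (if o then u else v)) ->
  det2 u v != 0 ->
  let n := ~~ (0 < det2 u v) in
  crossing_sign D (chart_inv c z) = (-1) ^+ n /\
  forall (X : choiceType) (C : set F -> X) (x y : bool), \forall s \near (0 : R)^'+,
    side_color C D (chart_inv c z) x y =
    C (region D (chart_inv c (z + s *: ((-1) ^+ (~~ y (+) n) *: u + (-1) ^+ (x (+) n) *: v)))).
Proof.
move=> hl dz su sv all_uv duv n.
have [d Ez hz] := disk_inv dz; set p := chart_inv c z in d Ez hz *.
have [hpos hcol] : positive D p = (0 < det2 u v) /\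
  forall (X : choiceType) (C : set F -> X) (a b : bool), \forall s \near (0 : R)^'+,
    corner_color C D p ((-1) ^+ a *: direction D p true + (-1) ^+ b *: direction D p false)
    = C (region D (chart_inv c (z + s *: ((-1) ^+ a *: u + (-1) ^+ b *: v)))).
  rewrite -[in X in _ /\ X]Ez; apply: crossing_in_chart => //; rewrite ?Ez.
  - exact/hl.
  - exact/hl.
  - by move=> w o /hl => /(_ dz) /all_uv.
split; first by rewrite /crossing_sign hpos /n; case: (0 < det2 u v).
move=> X C x y.
apply: filterS (hcol X C (~~ y (+) n) (x (+) n)) => s <-.
rewrite /side_color /color_a /color_b /color_c /color_d /left_color /right_color
  /bottom_color /top_color /heading_left /heading_right hpos /n.
by case: (0 < det2 u v); case: x; case: y => /=; congr corner_color;
  rewrite ?expr0 ?expr1 ?scale1r ?scaleN1r ?opprD // addrC.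
Qed.

End OneDisk.
End DiskChart.

(** * Pictures made of graphs of polynomials of degree at most two *)

Section Quadratic.
Context (R : realType).
Implicit Types z : 'rV[R]_2.

Lemma near_affine_gt0 (a b : R) : 0 < a -> \forall s \near (0 : R)^'+, 0 < a + s * b.
Proof.
move=> a0; have d0 : 0 < a / (`|b| + 1) by rewrite divr_gt0 // ltr_wpDl.
near=> s.
have s0 : 0 < s by near: s; exact: nbhs_right_gt.
have : s < a / (`|b| + 1) by near: s; exact: nbhs_right_lt.
rewrite ltr_pdivlMr; last by rewrite ltr_wpDl.
have : - `|b| <= b by rewrite lerNl -normrN ler_norm.
have : 0 <= `|b| by exact: normr_ge0.
by move: (`|b|) => c h1 h2 h3; nra.
Unshelve. all: by end_near. Qed.

(** For small positive [s] the first nonzero coefficient decides. The second alternative serves the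
    two graphs through a crossing, where the constant term vanishes. *)
Lemma near_quadratic_gt0 (a b c : R) : 0 < a \/ a = 0 /\ 0 < b ->
  \forall s \near (0 : R)^'+, 0 < a + s * b + s ^+ 2 * c.
Proof.
case=> [a0|[-> b0]]; near=> s.
- have s0 : 0 < s by near: s; exact: nbhs_right_gt.
  have s1 : s < 1 by near: s; exact: nbhs_right_lt.
  have : 0 < a + s * (- (`|b| + `|c|)) by near: s; exact: near_affine_gt0.
  have : - `|b| <= b by rewrite lerNl -normrN ler_norm.
  have : - `|c| <= c by rewrite lerNl -normrN ler_norm.
  have : 0 <= `|c| by [].
  move: (`|b|) (`|c|) => b' c' c'0 hc hb h.
  have h1 : - s * b' <= s * b by nra.
  have h2 : s ^+ 2 * (c + c') >= 0 by rewrite mulr_ge0 ?sqr_ge0 //; lra.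
  have h3 : s ^+ 2 * c' <= s * c' by rewrite ler_wpM2r //; nra.
  by nra.
- have s0 : 0 < s by near: s; exact: nbhs_right_gt.
  have : 0 < b + s * c by near: s; exact: near_affine_gt0.
  by move=> h; rewrite add0r expr2 -mulrA -mulrDr mulr_gt0.
Unshelve. all: by end_near. Qed.

Context (q r d : nat -> R).

Definition quad (k : nat) (x : R) : R := q k * x ^+ 2 + r k * x + d k.
Definition slope (k : nat) (x : R) : R := 2 * q k * x + r k.

Context (n : nat) (e : 'I_n -> bool) (h : 'S_n).
Local Notation m := (graphs quad e h).

Definition heading (k : 'I_n) (x : R) : 'rV[R]_2 := (-1) ^+ e k *: pt 1 (slope k x).

Lemma graph_arc (k : 'I_n) t (x := (-1) ^+ e k * t) :
  Defs.arc (t := m) k t = pt x (quad k x).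
Proof. by []. Qed.

Lemma graph_velocity (k : 'I_n) t :
  derive1 (Defs.arc (t := m) k) t = heading k ((-1) ^+ e k * t).
Proof.
set s := (-1) ^+ e k : R.
have -> : Defs.arc (t := m) k = fun t => pt (s * t) (quad k (s * t)) by [].
have d1 : is_derive t 1 (fun t => s * t) s.
  rewrite (_ : (fun _ => _) = s *: id); last by apply: funext.
  by apply: is_derive_eq; rewrite [s *: _]mulr1.
have d2 : is_derive t 1 (fun t => quad k (s * t)) (s * slope k (s * t)).
  rewrite (_ : (fun _ => _) = (cst (q k * s ^+ 2) * id + cst (r k * s)) * id + cst (d k)).
    apply: is_derive_eq; rewrite /slope !fctE /GRing.scale /=; ring.
  by apply: funext => t'; rewrite /quad !fctE /GRing.scale /=; ring.
rewrite (derive1_pt d1 d2) /heading -/s; apply: rV2P; rewrite !mxE /=.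
  by rewrite mulr1.
by [].
Qed.

Lemma graph_over (k : 'I_n) t (x := (-1) ^+ e k * t) :
  @tangle_over R m k t <-> exists k' : 'I_n, quad k' x = quad k x /\ (h k' < h k)%N.
Proof.
split=> [[k' [t' []]]|[k' [E lt]]].
  rewrite !graph_arc /= ltr_nat => E lt; exists k'; split => //.
  have E0 := congr1 (fun z : 'rV[R]_2 => z 0 0) E; have := congr1 (fun z : 'rV[R]_2 => z 0 1) E.
  by rewrite !pt1; rewrite !pt0 in E0; rewrite E0.
exists k', ((-1) ^+ e k' * x); rewrite !graph_arc /= ltr_nat; split => //.
by rewrite mulrA -expr2 sqrr_sign mul1r E.
Qed.

Lemma graph_strandP x y w o : tangle_strand m (pt x y) w o <->
  exists k : 'I_n, [/\ quad k x = y, exists2 l : R, 0 < l & w = l *: heading k x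
    & (exists k' : 'I_n, quad k' x = y /\ (h k' < h k)%N) <-> o].
Proof.
split=> [[k [t [l [l0]]]]|[k [E [l l0 Ew] ov]]].
  rewrite graph_arc graph_velocity graph_over.
  set x' := _ * t => E vl; have := congr1 (fun z : 'rV[R]_2 => z 0 1) E.
  have := congr1 (fun z : 'rV[R]_2 => z 0 0) E; rewrite !pt0 !pt1 => Ex <-.
  rewrite -Ex => ov; exists k; split => //; exists l^-1; first by rewrite invr_gt0.
  by rewrite vl scalerA mulVf ?gt_eqF // scale1r.
exists k, ((-1) ^+ e k * x), l^-1.
have Ex : (-1) ^+ e k * ((-1) ^+ e k * x) = x.
  by rewrite mulrA -expr2 sqrr_sign mul1r.
split; rewrite ?invr_gt0 // ?graph_arc ?graph_velocity ?graph_over ?Ex ?E //.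
by rewrite Ew scalerA mulVf ?gt_eqF // scale1r.
Qed.

Lemma det2_heading (k l : 'I_n) x : det2 (heading k x) (heading l x) =
  (-1) ^+ (e k (+) e l) * (slope l x - slope k x).
Proof. by rewrite det2Z /det2 !pt0 !pt1 signr_addb; ring. Qed.

(* [s j] tells whether the points lie below the [j]-th graph. *)
Definition sector (s : 'I_n -> bool) : set 'rV[R]_2 :=
  [set z | unit_disk z /\ forall j, 0 < (-1) ^+ s j * (z 0 1 - quad j (z 0 0))].

(** Membership of [z0] follows from [l = 1] once [A] is inhabited. For empty [A] the property is
    vacuous, so sectors that do not occur in a picture need no separate treatment. *)
Definition star (A : set 'rV[R]_2) z0 : Prop :=
  forall z, A z -> forall l : R, 0 <= l <= 1 -> A (seg z z0 l).

Lemma sector_arc s z (k : 'I_n) t : sector s z -> Defs.arc (t := m) k t <> z.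
Proof.
move=> [_ /(_ k)] /[swap] <-; rewrite graph_arc pt0 pt1 subrr mulr0.
by rewrite ltxx.
Qed.

Lemma quad_seg k z z0 (l : R) : let zl := seg z z0 l in
  zl 0 1 - quad k (zl 0 0) = (1 - l) * (z 0 1 - quad k (z 0 0)) +
    l * (z0 0 1 - quad k (z0 0 0)) + l * (1 - l) * (q k * (z0 0 0 - z 0 0) ^+ 2).
Proof. by rewrite /= /seg /quad !mxE; ring. Qed.

(** On a segment the height over a parabola is the linear interpolation plus a defect with factor
    [l * (1 - l)]. Writing the weight [l] of the endpoint [z0] as [l ^+ 2 + l * (1 - l)] lets half
    of its positive contribution absorb the defect; the second inequality says that it suffices. *)
Lemma star_sector s z0 : unit_disk z0 ->
  (forall z, sector s z -> forall j : 'I_n, 0 < (-1) ^+ s j * (z0 0 1 - quad j (z0 0 0)) /\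
     0 <= (-1) ^+ s j * (z0 0 1 - quad j (z0 0 0)) + (-1) ^+ s j * q j * (z0 0 0 - z 0 0) ^+ 2) ->
  star (sector s) z0.
Proof.
move=> dz0 hs z hz l l01; have [dz pz] := hz.
split; first exact: unit_disk_seg.
move=> j; rewrite quad_seg; have [] := hs _ hz j; have := pz j.
move: ((-1) ^+ s j) (z 0 1 - _) (z0 0 1 - _) ((z0 0 0 - z 0 0) ^+ 2) (q j) => t a b c q'.
move=> a0 b0 bc; case/andP: l01 => l0 l1.
have -> : t * ((1 - l) * a + l * b + l * (1 - l) * (q' * c)) =
  (1 - l) * (t * a) + l * (l * (t * b)) + l * ((1 - l) * (t * b + t * q' * c)) by ring.
have h3 : 0 <= l * ((1 - l) * (t * b + t * q' * c)) by rewrite !mulr_ge0 // subr_ge0.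
have [->|ln] := eqVneq l 1; first by lra.
have h1 : 0 < (1 - l) * (t * a) by rewrite mulr_gt0 // subr_gt0 lt_neqAle ln.
have h2 : 0 <= l * (l * (t * b)) by apply: mulr_ge0 => //; apply: mulr_ge0 => //; exact: ltW.
lra.
Qed.

Context (F : topologicalType) (S : oriented_surface R F).
Context (U : set F) (c : chart R F) (hU : disk_chart S U c) (D : diagram S).
Hypothesis hl : looks_like c D m.

Lemma graph_region s z z0 : star (sector s) z0 -> sector s z ->
  region D (chart_inv c z) = region D (chart_inv c z0).
Proof.
move=> st sz; apply: (disk_segment_region hU hl) => l l01.
have hz := st _ sz _ l01; split; first by case: hz.
by move=> k t; exact: sector_arc hz.
Qed.

Lemma graph_crossings : crossings D `&` U =
  [set p | exists (k l : 'I_n) (x : R), [/\ unit_disk (pt x (quad k x)), quad l x = quad k x,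
    (h l < h k)%N & p = chart_inv c (pt x (quad k x))]].
Proof.
rewrite (disk_crossings hU hl); apply/seteqP; split.
  move=> _ [z [dz [v hv]] <-]; move: hv.
  have Ez : z = pt (z 0 0) (z 0 1) by apply: rV2P; rewrite ?pt0 ?pt1.
  rewrite Ez => /graph_strandP[k [Ek _ [_ /(_ isT)[l [El lt]]]]].
  by exists k, l, (z 0 0); rewrite Ek -Ez; split => //; rewrite -Ez.
move=> _ [k [l [x [dz El lt ->]]]]; exists (pt x (quad k x)) => //; split => //.
exists (heading k x); apply/graph_strandP; exists k; split => //.
  by exists 1 => //; rewrite scale1r.
by split => // _; exists l.
Qed.

(** A short step from the crossing into the corner lands in the sector [s], and from there a segment
    leads to [z0]. To the right of a graph means below it when the graph is traversed in the
    direction of increasing [x], and above it otherwise; hence [s k = e k (+) a]. *)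
Lemma graph_crossing (k l : 'I_n) x (z := pt x (quad k x))
    (nu := ~~ (0 < det2 (heading k x) (heading l x))) :
  x ^+ 2 + quad k x ^+ 2 < 1 -> quad l x = quad k x -> (h l < h k)%N ->
  slope k x != slope l x ->
  (forall j : 'I_n, j != k -> j != l -> quad j x != quad k x) ->
  crossing_sign D (chart_inv c z) = (-1) ^+ nu /\
  forall (X : choiceType) (C : set F -> X) (a b : bool) (s : 'I_n -> bool) z0,
    s k = e k (+) a -> s l = e l (+) b ->
    (forall j : 'I_n, j != k -> j != l -> 0 < (-1) ^+ s j * (quad k x - quad j x)) ->
    star (sector s) z0 ->
    side_color C D (chart_inv c z) a b = C (region D (chart_inv c z0)).
Proof.
move=> din El lt dsl nj.
have dz : unit_disk z by rewrite /unit_disk /= /z pt0 pt1 ltW.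
have kl : k != l by apply: contraTneq lt => ->; rewrite ltnn.
have duv : det2 (heading k x) (heading l x) != 0.
  by rewrite det2_heading mulf_neq0 ?signr_eq0 // subr_eq0 eq_sym.
have su : tangle_strand m z (heading k x) true.
  apply/graph_strandP; exists k; split => //; first by exists 1; rewrite ?scale1r.
  by split => // _; exists l.
have nl : ~ (exists k' : 'I_n, quad k' x = quad k x /\ (h k' < h l)%N).
  move=> [k' [E lt']].
  have [Ek|nk] := eqVneq k' k; first by rewrite Ek ltnNge (ltnW lt) in lt'.
  have [Ek|nk'] := eqVneq k' l; first by rewrite Ek ltnn in lt'.
  by have := nj _ nk nk'; rewrite E eqxx.
have sv : tangle_strand m z (heading l x) false.
  apply/graph_strandP; exists l; split => //; first by exists 1; rewrite ?scale1r.
have all_uv w o : tangle_strand m z w o ->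
     exists2 a : R, 0 < a & w = a *: (if o then heading k x else heading l x).
  move=> /graph_strandP[j [Ej [a a0 Ew] ov]]; exists a => //.
  have [Ek|nk] := eqVneq j k.
    by rewrite Ew Ek (_ : o = true) //; apply/ov; exists l; rewrite Ek.
  have [Ek|nk'] := eqVneq j l; last by have := nj _ nk nk'; rewrite Ej eqxx.
  rewrite Ew Ek; case: (o) ov => // -[_ /(_ isT)]; rewrite Ek => /nl; by [].
have [hs hc] := disk_crossing hU hl dz su sv all_uv duv.
split => // X C a b s z0 sk sl sj st.
set w := (-1) ^+ (~~ b (+) nu) *: heading k x + (-1) ^+ (a (+) nu) *: heading l x.
have sg (t : bool) (g : R) : g != 0 -> (-1) ^+ (~~ (0 < g)) * g > 0 :> R.
  move=> g0; have [gp|gn|E] := ltgtP 0 g; last by rewrite -E eqxx in g0.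
    by rewrite expr0 mul1r.
  by rewrite expr1 mulN1r oppr_gt0.
have dpos : 0 < (-1) ^+ nu * ((-1) ^+ (e k (+) e l) * (slope l x - slope k x)).
  by rewrite -det2_heading; exact: sg.
have near_sector : \forall t \near (0 : R)^'+, sector s (z + t *: w).
  have key : \forall t \near (0 : R)^'+, forall j : 'I_n,
      0 < (-1) ^+ s j * ((z + t *: w) 0 1 - quad j ((z + t *: w) 0 0)).
    apply: filter_forall => j.
    (* A graph not through the crossing is settled by the constant term. For [k] and [l] the linear
       coefficient is in both cases the determinant of the headings times its own sign. *)
    have hj : 0 < (-1) ^+ s j * (quad k x - quad j x) \/
        (-1) ^+ s j * (quad k x - quad j x) = 0 /\
        0 < (-1) ^+ s j * (w 0 1 - slope j x * w 0 0).
      have [->|nk] := eqVneq j k.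
        right; split; first by rewrite subrr mulr0.
        rewrite sk (_ : _ * _ = (-1) ^+ nu * ((-1) ^+ (e k (+) e l) * (slope l x - slope k x))) //.
        rewrite /w /heading !mxE /=.
        by case: (a); case: (b); case: (nu); case: (e k); case: (e l); rewrite /= ?expr0 ?expr1; ring.
      have [->|nk'] := eqVneq j l; last by left; exact: sj.
      right; split; first by rewrite El subrr mulr0.
      rewrite sl (_ : _ * _ = (-1) ^+ nu * ((-1) ^+ (e k (+) e l) * (slope l x - slope k x))) //.
      rewrite /w /heading !mxE /=.
      by case: (a); case: (b); case: (nu); case: (e k); case: (e l); rewrite /= ?expr0 ?expr1; ring.
    have := near_quadratic_gt0 (- ((-1) ^+ s j * q j * w 0 0 ^+ 2)) hj.
    apply: filterS => t ht; rewrite (_ : _ * _ = (-1) ^+ s j * (quad k x - quad j x)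
       + t * ((-1) ^+ s j * (w 0 1 - slope j x * w 0 0))
       + t ^+ 2 * - ((-1) ^+ s j * q j * w 0 0 ^+ 2)) //.
    rewrite (_ : (z + t *: w) 0 1 = quad k x + t * w 0 1); last by rewrite !mxE.
    rewrite (_ : (z + t *: w) 0 0 = x + t * w 0 0); last by rewrite !mxE.
    by rewrite /quad /slope; ring.
  have kd : \forall t \near (0 : R)^'+, unit_disk (z + t *: w).
    have := @near_quadratic_gt0 (1 - x ^+ 2 - quad k x ^+ 2)
      (- 2 * (x * w 0 0 + quad k x * w 0 1)) (- (w 0 0 ^+ 2 + w 0 1 ^+ 2)).
    move=> /(_ (or_introl _)); rewrite -addrA -opprD subr_gt0 => /(_ din).
    apply: filterS => t ht; rewrite /unit_disk /= -subr_ge0; apply: ltW.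
    rewrite (_ : (z + t *: w) 0 1 = quad k x + t * w 0 1); last by rewrite !mxE.
    rewrite (_ : (z + t *: w) 0 0 = x + t * w 0 0); last by rewrite !mxE.
    by apply: lt_le_trans ht _; rewrite le_eqVlt; apply/orP; left; apply/eqP; ring.
  by near=> t; split; near: t.
near ((0 : R)^'+) => t.
rewrite -(@graph_region s (z + t *: w) z0) //; last by near: t.
near: t; exact: hc.
Unshelve. all: by end_near. Qed.

End Quadratic.

(** * Chains *)

Section Chains.
Context (X : choiceType) (T L M N : X -> X -> X -> X).

Lemma freegU_sign (Y : choiceType) (b : bool) (x : Y) :
  << (-1) ^+ b *g x >> = (if b then - << x >> else << x >>) :> {freeg Y}.
Proof. by case: b; rewrite ?expr1 ?expr0 // freegUN. Qed.

Lemma boundary_generator x0 x1 x2 x3 : boundary T << [tuple x0; x1; x2; x3] >> =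
  (<< [tuple x1; x2; x3] >>
    - << [tuple x0; T x0 x1 x2; T (T x0 x1 x2) x2 x3] >>)
  - (<< [tuple T x0 x1 x2; x2; x3] >> - << [tuple x0; x1; T x1 x2 x3] >>)
  + (<< [tuple T x0 x1 (T x1 x2 x3); T x1 x2 x3; x3] >> - << [tuple x0; x1; x2] >>)
  :> {freeg 3.-tuple X}.
Proof.
rewrite /boundary liftU scale1r /boundary_tuple !big_ord_recl big_ord0 addr0.
set t := [tuple x0; x1; x2; x3].
have c0 : Defs.coord t 0 = x0 by rewrite /Defs.coord (tnth_nth x0) /= inordK.
have c1 : Defs.coord t 1 = x1 by rewrite /Defs.coord (tnth_nth x0) /= inordK.
have c2 : Defs.coord t 2 = x2 by rewrite /Defs.coord (tnth_nth x0) /= inordK.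
have c3 : Defs.coord t 3 = x3 by rewrite /Defs.coord (tnth_nth x0) /= inordK.
have tup (f : 'I_3 -> X) y0 y1 y2 : f ord0 = y0 -> f (inord 1) = y1 -> f (inord 2) = y2 ->
    [tuple f k | k < 3] = [tuple y0; y1; y2].
  move=> <- <- <-; apply: eq_from_tnth => i; rewrite tnth_mktuple (tnth_nth x0).
  case: i => [[|[|[|//]]] hi] /=; congr f; apply: val_inj => /=; by rewrite ?inordK.
have v1 : val (inord 1 : 'I_3) = 1%N by rewrite /= inordK.
have v2 : val (inord 2 : 'I_3) = 2%N by rewrite /= inordK.
have L0 : faceL T t 0 = [tuple x1; x2; x3].
  by apply: tup; rewrite ?v1 ?v2 /dL /= ?c1 ?c2 ?c3.
have L1 : faceL T t 1 = [tuple T x0 x1 x2; x2; x3].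
  by apply: tup; rewrite ?v1 ?v2 /dL /= ?c0 ?c1 ?c2 ?c3.
have L2 : faceL T t 2 = [tuple T x0 x1 (T x1 x2 x3); T x1 x2 x3; x3].
  by apply: tup; rewrite ?v1 ?v2 /dL /= ?c0 ?c1 ?c2 ?c3.
have R0 : faceR T t 0 = [tuple x0; T x0 x1 x2; T (T x0 x1 x2) x2 x3].
  by apply: tup; rewrite ?v1 ?v2 /dR /= ?c0 ?c1 ?c2 ?c3.
have R1 : faceR T t 1 = [tuple x0; x1; T x1 x2 x3].
  by apply: tup; rewrite ?v1 ?v2 /dR /= ?c0 ?c1 ?c2 ?c3.
have R2 : faceR T t 2 = [tuple x0; x1; x2].
  by apply: tup; rewrite ?v1 ?v2 /dR /= ?c0 ?c1 ?c2 ?c3.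
rewrite -L0 -L1 -L2 -R0 -R1 -R2 expr0 expr1 sqrrN expr1n !scale1r scaleN1r.
by rewrite addrA.
Qed.

Lemma boundaryB n (w w' : chains X n.+1) : boundary T (w - w') = boundary T w - boundary T w'.
Proof. exact: lift_is_additive. Qed.

Lemma boundary0 n : boundary T (0 : chains X n.+1) = 0.
Proof. by rewrite -[X in boundary T X](subrr 0) boundaryB subrr. Qed.

Lemma boundaryN n (w : chains X n.+1) : boundary T (- w) = - boundary T w.
Proof. by rewrite -sub0r boundaryB boundary0 sub0r. Qed.

Lemma degenerate_chainN n (w : chains X n) :
  degenerate_chain L N w -> degenerate_chain L N (- w).
Proof. by move=> dw; rewrite -sub0r; apply: generatedB dw; exact: generated0. Qed.

Lemma homologousW n (w w' : chains X n) : homologous T w w' -> homologousN T L N w w'.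
Proof. by case=> v E; exists v; rewrite E subrr; exact: generated0. Qed.

(* [K x y z] is the color at the sides [x], [y], [z] of the upper, the middle
   and the lower strand; [TM], [TB] and [MB] are the crossings of two of them. *)
Lemma cube_boundary (K : bool -> bool -> bool -> X) :
  (forall t, K false true t = T (K false false t) (K true false t) (K true true t)) ->
  (forall t, K false t true = T (K false t false) (K true t false) (K true t true)) ->
  (forall t, K t false true = T (K t false false) (K t true false) (K t true true)) ->
  let TM t := [tuple K false false t; K true false t; K true true t] in
  let TB t := [tuple K false t false; K true t false; K true t true] in
  let MB t := [tuple K t false false; K t true false; K t true true] in
  boundary T << [tuple K false false false; K true false false; K true true false; K true true true] >> =
  - (<< TM false >> - << TM true >>) + (<< TB false >> - << TB true >>)
  - (<< MB false >> - << MB true >>) :> {freeg 3.-tuple X}.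
Proof.
move=> hTM hTB hMB TM TB MB; rewrite boundary_generator /TM /TB /MB.
(* The generator is a monotone path of four vertices of the cube; these rules compute the other
   four. *)
rewrite -(hTM false) -(hTB true) -(hMB true) -(hTB false) !opprB.
by rewrite addrC [X in _ + X]addrC addrA.
Qed.

(* [t1], [t2], [t3] are the sides of the third strand on which the three
   crossings lie before the move. *)
Lemma cube_chain (K : bool -> bool -> bool -> X) (eta t1 t2 t3 : bool) :
  (forall t, K false true t = T (K false false t) (K true false t) (K true true t)) ->
  (forall t, K false t true = T (K false t false) (K true t false) (K true t true)) ->
  (forall t, K t false true = T (K t false false) (K t true false) (K t true true)) ->
  let TM t := [tuple K false false t; K true false t; K true true t] in
  let TB t := [tuple K false t false; K true t false; K true t true] in
  let MB t := [tuple K t false false; K t true false; K t true true] in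
  homologous T
    (<< (-1) ^+ (eta (+) t1) *g TM t1 >> + << (-1) ^+ (~~ eta (+) t2) *g TB t2 >>
      + << (-1) ^+ (eta (+) t3) *g MB t3 >> : chains X 1)
    (<< (-1) ^+ (eta (+) t1) *g TM (~~ t1) >> + << (-1) ^+ (~~ eta (+) t2) *g TB (~~ t2) >>
      + << (-1) ^+ (eta (+) t3) *g MB (~~ t3) >>).
Proof.
move=> hTM hTB hMB TM TB MB.
(* The sign changes with [t] as the order of the two opposite faces does, so the difference depends
   only on [a]. *)
have pair (a t : bool) (f : bool -> 3.-tuple X) :
    << (-1) ^+ (a (+) t) *g f t >> - << (-1) ^+ (a (+) t) *g f (~~ t) >> =
    (if a then - (<< f false >> - << f true >>) else << f false >> - << f true >>) :> {freeg 3.-tuple X}.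
  by rewrite !freegU_sign; case: a; case: t => /=; rewrite ?opprB ?opprK // addrC.
have E := cube_boundary hTM hTB hMB.
set w := << _ >> in E.
exists (if eta then w else - w).
rewrite !opprD [X in X = _]addrACA [X in X + _ = _]addrACA !pair.
by case: eta; rewrite /= ?boundaryN E -/TM -/TB -/MB ?opprD ?opprK // !opprB.
Qed.

Lemma cross_chain_cancel (K K' : bool -> bool -> X) (nu a0 b0 : bool) : is_KTQ T L M N ->
  K false true = T (K false false) (K true false) (K true true) ->
  K' false true = T (K' false false) (K' true false) (K' true true) ->
  (forall a b, (a, b) != (a0, b0) -> K a b = K' a b) ->
  << (-1) ^+ nu *g [tuple K false false; K true false; K true true] >>
  + << (-1) ^+ ~~ nu *g [tuple K' false false; K' true false; K' true true] >> = 0 :> {freeg 3.-tuple X}.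
Proof.
move=> [quasi _ _] h h' agr.
have E a b : K a b = K' a b.
  have [[-> ->]|ne] := eqVneq (a, b) (a0, b0); last exact: agr.
  have e a1 b1 : (a1 != a0) || (b1 != b0) -> K a1 b1 = K' a1 b1.
    by move=> ne; apply: agr; rewrite xpair_eqE negb_and.
  (* The unknown corner is, in this order, the third argument of [T], the second one, the value, and
     the first argument. *)
  move: h h' {agr}; case: a0 e; case: b0 => e.
  - rewrite (e false false) // (e true false) // (e false true) // => h h'.
    have [_ _ [+ _]] := quasi (K' false false) (K' true false) (K true true).
    have [_ _ [+ _]] := quasi (K' false false) (K' true false) (K' true true).
    by rewrite -h -h' => -> ->.
  - rewrite (e false false) // (e true true) // (e false true) // => h h'.
    have [_ [+ _] _] := quasi (K' false false) (K true false) (K' true true).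
    have [_ [+ _] _] := quasi (K' false false) (K' true false) (K' true true).
    by rewrite -h -h' => -> ->.
  - by rewrite (e false false) // (e true false) // (e true true) // => -> ->.
  - rewrite (e true true) // (e true false) // (e false true) // => h h'.
    have [[+ _] _ _] := quasi (K false false) (K' true false) (K' true true).
    have [[+ _] _ _] := quasi (K' false false) (K' true false) (K' true true).
    by rewrite -h -h' => -> ->.
rewrite !E; set t := [tuple _; _; _].
by case: nu; rewrite !freegU_sign /= ?addNr ?addrN.
Qed.

(** Solving [T x y z = y] for the last argument gives [z = N x y y]. *)
Lemma degenerate_crossing (b : bool) (x y z : X) : is_KTQ T L M N -> T x y z = y ->
  degenerate_chain L N (<< (-1) ^+ b *g [tuple x; y; z] >> : {freeg 3.-tuple X}).
Proof.
move=> [quasi _ _] E.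
have d : degenerate_chain L N (<< [tuple x; y; z] >> : {freeg 3.-tuple X}).
  apply: generated_in; exists [tuple x; y; z] => //.
  exists 0%N, x, y; split => //; left.
  have [_ _ [E' _]] := quasi x y z; rewrite E in E'.
  by rewrite /Defs.coord !(tnth_nth x) /= !inordK //= E'.
by rewrite freegU_sign; case: b => //; exact: degenerate_chainN.
Qed.

End Chains.

(** * The three moves *)

Section MoveOne.
Context (X : choiceType) (T L M N : X -> X -> X -> X) (hX : is_KTQ T L M N).
Context (R : realType) (F : topologicalType) (S : oriented_surface R F).
Context (U : set F) (c : chart R F) (hU : disk_chart S U c) (D : diagram S) (C : set F -> X).

Lemma inner_chain0 : crossings D `&` U = set0 -> inner_chain C U D = 0.
Proof. by rewrite /inner_chain => ->; rewrite fsbig_set0. Qed.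

Lemma chord_chain e : looks_like c D (@chord R e) -> inner_chain C U D = 0.
Proof.
move=> hl; apply: inner_chain0; rewrite (disk_crossings hU hl).
rewrite -subset0 => p [z [dz [v [k [t [l [_ _ _ [_ ov]]]]]]] _].
by have [k' [t' [_]]] := ov isT; rewrite /= ltxx.
Qed.

Section Kink.
Context (e w : bool).
Hypothesis hl : looks_like c D (@kink R e w).
Local Notation m := (@kink R e w).
Local Notation kx t := ((t ^+ 2 - 1) / 5 : R).
Local Notation ky t := (2 / 15 * (t ^+ 3 - t) : R).

Lemma kink_arc (k : 'I_1) t (s := (-1) ^+ e * t) :
  Defs.arc (t := m) k t = pt (kx s) (ky s).
Proof. by []. Qed.

(** The parameter is eliminated from [y = 2 / 3 * s * x] and [s ^+ 2 = 5 * x + 1]. With this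
    equation, avoiding the curve becomes a polynomial inequality. *)
Lemma kink_cubic (k : 'I_1) t (z : 'rV[R]_2) : Defs.arc (t := m) k t = z ->
  z 0 1 ^+ 2 = 4 / 9 * z 0 0 ^+ 2 * (5 * z 0 0 + 1).
Proof.
move=> <-; rewrite kink_arc; move: (_ * t) => s; rewrite pt0 pt1.
by field.
Qed.

Lemma kink_velocity (k : 'I_1) t : derive1 (Defs.arc (t := m) k) t =
  (-1) ^+ e *: pt (2 / 5 * ((-1) ^+ e * t)) (2 / 15 * (3 * t ^+ 2 - 1)).
Proof.
set s := (-1) ^+ e : R; have s2 : s ^+ 2 = 1 by rewrite sqrr_sign.
have -> : Defs.arc (t := m) k = fun t => pt (kx (s * t)) (ky (s * t)) by [].
have d1 : is_derive t 1 (fun t => kx (s * t)) (2 / 5 * t).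
  rewrite (_ : (fun _ => _) = (1 / 5) *: (id ^+ 2) + cst (- (1 / 5))); last first.
    apply: funext => t'; rewrite exprMn s2 !fctE /GRing.scale /=; ring.
  apply: is_derive_eq; rewrite /= expr1 /GRing.scale /=; ring.
have d2 (a : R) : is_derive t 1 (fun t => a * ((s * t) ^+ 3 - s * t)) (s * (a * (3 * t ^+ 2 - 1))).
  rewrite (_ : (fun _ => _) = (a * s) *: (id ^+ 3 - id)); last first.
    apply: funext => t'; rewrite exprMn (exprSr s 2) s2 !fctE /GRing.scale /=; ring.
  apply: is_derive_eq; rewrite /= /GRing.scale /=; ring.
rewrite (derive1_pt d1 (d2 _)); apply: rV2P; rewrite !mxE //=.
by rewrite [RHS](_ : _ = s ^+ 2 * (2 / 5 * t)); [rewrite s2 mul1r | ring].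
Qed.

Lemma kink_origin (k : 'I_1) t : Defs.arc (t := m) k t = 0 <-> t ^+ 2 = 1.
Proof.
rewrite kink_arc; have st : ((-1) ^+ e * t) ^+ 2 = t ^+ 2 by rewrite exprMn sqrr_sign mul1r.
split=> [E|E].
  have := congr1 (fun z : 'rV[R]_2 => z 0 0) E; rewrite pt0 mxE st => h.
  by lra.
apply: rV2P; rewrite ?pt0 ?pt1 mxE; first by rewrite st E subrr mul0r.
by rewrite exprS st E mulr1 subrr mulr0.
Qed.

(** Two distinct parameters with the same first coordinate are opposite; equality of the second
    coordinates then forces them to be 1 and -1, and the height selects one. *)
Lemma kink_over (k : 'I_1) t : @tangle_over R m k t <-> t = (-1) ^+ w.
Proof.
have sw (b : bool) : ((-1) ^+ b : R) ^+ 2 = 1 by rewrite sqrr_sign.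
split=> [[k' [t' []]]|->].
  rewrite !kink_arc /=; set s := (-1) ^+ e : R => E lt.
  have := congr1 (fun z : 'rV[R]_2 => z 0 0) E; have := congr1 (fun z : 'rV[R]_2 => z 0 1) E.
  rewrite !pt0 !pt1 => E1 E0.
  have tt : t' ^+ 2 = t ^+ 2.
    by move: E0; rewrite !exprMn sw !mul1r => h; lra.
  have nt : t' != t by apply: contraTneq lt => ->; rewrite ltxx.
  have t'E : t' = - t.
    have : (t' - t) * (t' + t) = 0 by rewrite -subr_sqr tt subrr.
    by move/eqP; rewrite mulf_eq0 subr_eq0 (negPf nt) addr_eq0 => /eqP.
  have t0 : t != 0 by apply: contraNneq nt => t0; rewrite t'E t0 oppr0.
  have t1 : t ^+ 2 = 1.
    move: E1; rewrite t'E mulrN (exprNn (s * t)) => E1.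
    have : s * t * ((s * t) ^+ 2 - 1) = 0.
      by move: E1; rewrite (exprS _ 2); move: (s * t) => u; rewrite !exprS expr0; lra.
    move/eqP; rewrite mulf_eq0 mulf_eq0 signr_eq0 (negPf t0) /= subr_eq0 => /eqP.
    by rewrite exprMn sw mul1r.
  move: lt; rewrite t'E mulrN => lt.
  have : (t - (-1) ^+ w) * (t + (-1) ^+ w) = 0 by rewrite -subr_sqr t1 sw subrr.
  move/eqP; rewrite mulf_eq0 subr_eq0 addr_eq0 => /orP[/eqP //|/eqP E'].
  by move: lt; rewrite E' mulrN -expr2 sw; lra.
exists k, (- (-1) ^+ w); split; last by rewrite /= mulrN -expr2 sw; lra.
by rewrite (kink_origin _ _).2 ?sqrrN ?sw // (kink_origin _ _).2 ?sw.
Qed.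

Let u (o : bool) : 'rV[R]_2 := pt ((-1) ^+ (w (+) ~~ o) * (2 / 5)) ((-1) ^+ e * (4 / 15)).

Lemma kink_strand v o : tangle_strand m 0 v o <-> exists2 l : R, 0 < l & v = l *: u o.
Proof.
have vel (t : R) (b : bool) : t = (-1) ^+ b -> (-1) ^+ e *: pt (2 / 5 * ((-1) ^+ e * t)) (2 / 15 * (3 * t ^+ 2 - 1))
    = pt ((-1) ^+ b * (2 / 5)) ((-1) ^+ e * (4 / 15)).
  move=> ->; apply: rV2P; rewrite !mxE /= ?sqrr_sign; last by field.
  rewrite [LHS](_ : _ = ((-1) ^+ e) ^+ 2 * ((-1) ^+ b * (2 / 5))); last by ring.
  by rewrite sqrr_sign mul1r.
split=> [[k [t [l [l0]]]]|[l l0 ->]].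
  rewrite kink_origin kink_over kink_velocity => t2 vl ov.
  have tE : t = (-1) ^+ (w (+) ~~ o).
    case: o ov => [[_ ->]|[ov _]] //; first by rewrite addbF.
    rewrite addbT.
    have : (t - (-1) ^+ w) * (t + (-1) ^+ w) = 0 by rewrite -subr_sqr t2 sqrr_sign subrr.
    move/eqP; rewrite mulf_eq0 subr_eq0 addr_eq0 => /orP[/eqP /ov //|/eqP ->].
    by rewrite signrN.
  exists l^-1; first by rewrite invr_gt0.
  by rewrite /u -(vel _ _ tE) vl scalerA mulVf ?gt_eqF // scale1r.
exists ord0, ((-1) ^+ (w (+) ~~ o)), l^-1.
split; rewrite ?invr_gt0 //.
- by apply/kink_origin; rewrite sqrr_sign.
- by rewrite kink_velocity (vel _ _ erefl) scalerA mulVf ?gt_eqF // scale1r.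
rewrite kink_over; case: o; rewrite ?addbF ?addbT //= signrN; split => // h.
by have /eqP : (-1) ^+ w = 0 :> R by [lra]; rewrite signr_eq0.
Qed.

Lemma kink_crossings : crossings D `&` U = [set chart_inv c 0].
Proof.
have d0 : unit_disk (0 : 'rV[R]_2) by rewrite /unit_disk /= !mxE expr0n addr0 ler01.
rewrite (disk_crossings hU hl); apply/seteqP; split => [_ [z [dz [v hv]] <-]|_ ->].
  move: hv => [k [t [l [_ <- _ [_ /(_ isT)]]]]]; rewrite kink_over => ->.
  by rewrite (kink_origin _ _).2 ?sqrr_sign.
exists 0 => //; split => //; exists (u true); apply/kink_strand.
by exists 1; rewrite ?scale1r.
Qed.

(* The path from above the node to below it goes around the loop, on the left. *)
Lemma kink_region (y : R) : 0 < y <= 1 / 5 ->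
  region D (chart_inv c (pt 0 y)) = region D (chart_inv c (pt 0 (- y))).
Proof.
move=> /andP[y0 y1].
have step a b a' b' : (forall l : R, 0 <= l <= 1 ->
      let x := a + l * (a' - a) in let y := b + l * (b' - b) in
      x ^+ 2 + y ^+ 2 <= 1 /\ 4 / 9 * x ^+ 2 * (5 * x + 1) < y ^+ 2) ->
    region D (chart_inv c (pt a b)) = region D (chart_inv c (pt a' b')).
  move=> h; apply: (disk_segment_region hU hl) => l /h /=.
  have -> : seg (pt a b) (pt a' b') l = pt (a + l * (a' - a)) (b + l * (b' - b)).
    by apply: rV2P; rewrite !mxE.
  move: (a + _) (b + _) => x x' [h1 h2]; split; first by rewrite /unit_disk /= pt0 pt1.
  by move=> k t E; have := @kink_cubic k _ _ E; rewrite pt0 pt1 => E'; rewrite E' ltxx in h2.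
(* The loop has [x] between [- (1 / 5)] and 0 and stays at heights below [1 / 5] in absolute value.
   The path passes through the corners of a rectangle around it, with left side at [x = - (1 / 4)],
   where the cubic has no point. *)
have h1 := @step 0 y 0 (1 / 5).
rewrite h1; last first.
  move=> l /andP[l0 l1] /=; rewrite subrr mulr0 addr0.
  have : y <= y + l * (1 / 5 - y) by rewrite lerDl mulr_ge0 // subr_ge0.
  have : y + l * (1 / 5 - y) <= 1 / 5 by nra.
  by move: (y + _) => t t1 t0; split; nra.
rewrite (@step 0 (1 / 5) (- (1 / 4)) (1 / 5)); last first.
  move=> l /andP[l0 l1] /=; rewrite subrr mulr0 addr0.
  set x := 0 + _; have x0 : x <= 0 by rewrite /x; lra.
  have x1 : - (1 / 4) <= x by rewrite /x; lra.
  have x2 : x ^+ 2 <= 1 / 16 by nra.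
  split; first by nra.
  have : 0 <= x ^+ 2 * (- x) by rewrite mulr_ge0 ?sqr_ge0 // oppr_ge0.
  by nra.
rewrite (@step (- (1 / 4)) (1 / 5) (- (1 / 4)) (- (1 / 5))); last first.
  move=> l /andP[l0 l1] /=; rewrite subrr mulr0 addr0.
  set x := _ + l * _; have x0 : x <= 1 / 5 by rewrite /x; lra.
  have x1 : - (1 / 5) <= x by rewrite /x; lra.
  by split; nra.
rewrite (@step (- (1 / 4)) (- (1 / 5)) 0 (- (1 / 5))); last first.
  move=> l /andP[l0 l1] /=; rewrite subrr mulr0 addr0.
  set x := _ + l * _; have x0 : x <= 0 by rewrite /x; lra.
  have x1 : - (1 / 4) <= x by rewrite /x; lra.
  have x2 : x ^+ 2 <= 1 / 16 by nra.
  split; first by nra.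
  have : 0 <= x ^+ 2 * (- x) by rewrite mulr_ge0 ?sqr_ge0 // oppr_ge0.
  by nra.
apply: step => l /andP[l0 l1] /=; rewrite subrr mulr0 addr0.
set t := _ + l * _.
have t0 : t <= - y by rewrite /t; nra.
have t1 : - (1 / 5) <= t by rewrite /t; nra.
by split; nra.
Qed.

Hypothesis hC : is_coloring T D C.

(** The two velocities at the node are mirror images in the vertical axis, so the corners with
    colors [b] and [d] contain the points of this axis just above and below the node, which
    [kink_region] connects. *)
Lemma kink_chain : degenerate_chain L N (inner_chain C U D).
Proof.
have small (t : R) : 0 < t -> t < 1 / 5 -> 0 < 2 * (4 / 15) * t <= 1 / 5.
  by move=> t0 t1; lra.
rewrite /inner_chain kink_crossings fsbig_set1.
have d0 : unit_disk (0 : 'rV[R]_2) by rewrite /unit_disk /= !mxE expr0n addr0 ler01.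
have su o : tangle_strand m 0 (u o) o by apply/kink_strand; exists 1; rewrite ?scale1r.
have duv : det2 (u true) (u false) != 0.
  rewrite /det2 /u !pt0 !pt1 addbF addbT signrN.
  rewrite (_ : _ - _ = (-1) ^+ w * (-1) ^+ e * (16 / 75)); last by field.
  by rewrite !mulf_neq0 ?signr_eq0 // gt_eqF.
have all_uv v o : tangle_strand m 0 v o ->
    exists2 l : R, 0 < l & v = l *: (if o then u true else u false).
  by move=> /kink_strand[l l0 ->]; exists l => //; case: (o).
have [hs hcol] := disk_crossing hU hl d0 (su true) (su false) all_uv duv.
rewrite /crossing_term hs; apply: (degenerate_crossing _ hX).
have cp : crossings D (chart_inv c 0).
  have : (crossings D `&` U) (chart_inv c 0) by rewrite kink_crossings.
  by case.
rewrite -(hC cp).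
change (side_color C D (chart_inv c 0) false true = side_color C D (chart_inv c 0) true false).
set nu := ~~ _ in hcol.
near ((0 : R)^'+) => t.
have t0 : 0 < t by near: t; exact: nbhs_right_gt.
have t1 : t < 1 / 5 by near: t; apply: nbhs_right_lt; lra.
have vertical (a b x y z t' : R) : pt 0 (x * y * (2 * b * t')) =
    0 + t' *: (x *: pt (z * a) (y * b) + x *: pt (- z * a) (y * b)).
  by apply: rV2P; rewrite !mxE /=; ring.
have -> : side_color C D (chart_inv c 0) false true =
    C (region D (chart_inv c (pt 0 ((-1) ^+ nu * (-1) ^+ e * (2 * (4 / 15) * t))))).
  rewrite (vertical (2 / 5) (4 / 15) _ _ ((-1) ^+ w)).
  near: t; have := hcol X C false true; rewrite /u /= addbF addbT signrN; exact.
have -> : side_color C D (chart_inv c 0) true false =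
    C (region D (chart_inv c (pt 0 (- (-1) ^+ nu * (-1) ^+ e * (2 * (4 / 15) * t))))).
  rewrite (vertical (2 / 5) (4 / 15) _ _ ((-1) ^+ w)).
  near: t; have := hcol X C true false; rewrite /u /= addbF addbT !signrN; exact.
rewrite !mulNr -signr_addb.
have hy := small t t0 t1.
case: (nu (+) e); rewrite ?expr0 ?expr1 ?mul1r ?mulN1r ?opprK; first symmetry;
  by congr (C _); exact: kink_region hy.
Unshelve. all: by end_near. Qed.
End Kink.
End MoveOne.

(** * Second move: two parabolas *)

Section MoveTwo.
Context (X : choiceType) (T L M N : X -> X -> X -> X) (hX : is_KTQ T L M N).
Context (R : realType) (F : topologicalType) (S : oriented_surface R F).
Context (U : set F) (c : chart R F) (hU : disk_chart S U c) (D : diagram S) (C : set F -> X).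
Context (e : 'I_2 -> bool) (h : 'S_2).

Lemma ord2_cases (j : 'I_2) : j = 0 \/ j = 1.
Proof. by case: (unliftP 0 j) => [k ->|->]; [right; rewrite (ord1 k) lift_ord2.1|left]. Qed.

Lemma parallel_chain : looks_like c D (graphs (@parallel_pair R) e h) -> inner_chain C U D = 0.
Proof.
have -> : @parallel_pair R = quad (fun=> 0) (fun=> 0) (fun k => (-1) ^+ k * (3 / 5)).
  by apply: funext => k; apply: funext => x; rewrite /quad !mul0r !add0r.
move=> hl; apply: inner_chain0; rewrite (graph_crossings hU hl).
rewrite -subset0 => p [k [l [x [_ + lt _]]]].
rewrite /quad !mul0r !add0r.
case: (ord2_cases k) lt => ->; case: (ord2_cases l) => ->; rewrite ?ltnn //= expr0 expr1 => _; lra.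
Qed.

Local Notation cq := (fun k : nat => (-1) ^+ k * (5 / 4) : R).
Local Notation cr := (fun _ : nat => 0 : R).
Local Notation cd := (fun k : nat => - ((-1) ^+ k * (1 / 5)) : R).

Definition crossed_center (s0 s1 : bool) : 'rV[R]_2 :=
  pt 0 (if s0 (+) s1 then 0 else (-1) ^+ s0).

(** The excluded sector, below the first parabola and above the second, is disconnected: it lies on
    both sides of the bigon. The others are the bigon, the part above and the part below. *)
Lemma crossed_star (s : 'I_2 -> bool) : ~~ (s 0 && ~~ s 1) ->
  star (sector cq cr cd s) (crossed_center (s 0) (s 1)).
Proof.
move=> ns; apply: star_sector.
  by rewrite /unit_disk /crossed_center /= pt0 pt1; case: (_ (+) _); rewrite ?sqrr_sign expr0n ?add0r ?addr0.
move=> z [+ hs] j; have := hs 0; have := hs 1.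
rewrite /unit_disk /quad /crossed_center /= !pt0 !pt1 expr0 expr1.
move: (z 0 0) (z 0 1) => x y.
by case: (ord2_cases j) => ->; move: ns; case: (s 0); case: (s 1) => //= _;
  rewrite ?expr0 ?expr1 => h1 h0 dz; split; nra.
Qed.

Lemma crossed_chain : looks_like c D (graphs (@crossed_pair R) e h) ->
  is_coloring T D C -> inner_chain C U D = 0.
Proof.
have -> : @crossed_pair R = quad cq cr cd.
  by apply: funext => k; apply: funext => x; rewrite /quad /crossed_pair; ring.
move=> hl hC.
have [k [l [kl lt kl2]]] : exists k l : 'I_2, [/\ k != l, (h l < h k)%N & forall j, j = k \/ j = l].
  have h01 : h 0 != h 1 by rewrite (inj_eq perm_inj).
  have [lt|lt|E] := ltngtP (h 0) (h 1); last by rewrite (val_inj E) eqxx in h01.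
    by exists 1, 0; split => // j; case: (ord2_cases j) => ->; [right|left].
  by exists 0, 1; split => // j; case: (ord2_cases j) => ->; [left|right].
have dq : cq l = - cq k.
  by move: kl; case: (ord2_cases k) => ->; case: (ord2_cases l) => ->; rewrite ?eqxx // => _;
    rewrite /= ?expr0 ?expr1; ring.
have dd : cd l = - cd k.
  by move: kl; case: (ord2_cases k) => ->; case: (ord2_cases l) => ->; rewrite ?eqxx // => _;
    rewrite /= ?expr0 ?expr1; ring.
pose xi (b : bool) : R := (-1) ^+ b * (2 / 5).
have q0 (j : 'I_2) b : quad cq cr cd j (xi b) = 0.
  by rewrite /quad /xi exprMn sqrr_sign; field.
pose p b := chart_inv c (pt (xi b) (quad cq cr cd k (xi b))).
have sl b : slope cq cr l (xi b) - slope cq cr k (xi b) = (-1) ^+ b * (- cq k * (8 / 5)).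
  by rewrite /slope dq /xi; move: (cq k) => a; field.
have a0 : - cq k * (8 / 5) != 0.
  by rewrite !mulf_neq0 ?oppr_eq0 ?mulf_neq0 ?signr_eq0 ?invr_eq0 ?pnatr_eq0.
have dsl b : slope cq cr k (xi b) != slope cq cr l (xi b).
  by rewrite eq_sym -subr_eq0 sl mulf_neq0 ?signr_eq0.
have din b : xi b ^+ 2 + quad cq cr cd k (xi b) ^+ 2 < 1.
  by rewrite q0 expr0n addr0 /xi exprMn sqrr_sign mul1r; lra.
have nj b (j : 'I_2) : j != k -> j != l -> quad cq cr cd j (xi b) != quad cq cr cd k (xi b).
  by case: (kl2 j) => -> ; rewrite eqxx.
pose nu b := ~~ (0 < det2 (heading cq cr e k (xi b)) (heading cq cr e l (xi b))).
have gc b := graph_crossing hU hl (din b) (etrans (q0 l b) (esym (q0 k b))) lt (dsl b) (nj b).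
have crs : crossings D `&` U = [set p false] `|` [set p true].
  rewrite (graph_crossings hU hl); apply/seteqP; split=> [q [k' [l' [x [dz El lt' ->]]]]|].
    have x2 : x ^+ 2 = (2 / 5) ^+ 2.
      move: lt' El; case: (ord2_cases k') => ->; case: (ord2_cases l') => ->; rewrite ?ltnn //= => _;
        rewrite /quad expr0 expr1 => H; lra.
    have : (x - 2 / 5) * (x + 2 / 5) = 0 by rewrite -subr_sqr x2 subrr.
    have Ek x' : quad cq cr cd k' x' = quad cq cr cd k x' \/ quad cq cr cd k' x' = - quad cq cr cd k x'.
      by case: (kl2 k') => ->; [left|right; rewrite /quad dq dd; ring].
    move/eqP; rewrite mulf_eq0 subr_eq0 addr_eq0 => /orP[|] /eqP xE; [left|right].
      have -> : x = xi false by rewrite /xi expr0 mul1r.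
      by rewrite q0 /p q0.
    have -> : x = xi true by rewrite /xi expr1 mulN1r.
    by rewrite q0 /p q0.
  have dz b : unit_disk (pt (xi b) (quad cq cr cd k (xi b))).
    by rewrite /unit_disk /= pt0 pt1 ltW.
  by move=> q [->|->]; exists k, l; [exists (xi false)|exists (xi true)]; split => //; rewrite !q0.
have pne : p false <> p true.
  have dz b : unit_disk (pt (xi b) (quad cq cr cd k (xi b))).
    by rewrite /unit_disk /= pt0 pt1 ltW.
  move=> E; have [_ E0 _] := disk_inv hU (dz false); have [_ E1 _] := disk_inv hU (dz true).
  have : xi false = xi true by rewrite -[LHS](pt0 _ (quad cq cr cd k (xi false))) -E0 -/(p false) E E1 pt0.
  by rewrite /xi expr0 expr1 => H; lra.
have cp b : crossings D (p b).
  have : (crossings D `&` U) (p b) by rewrite crs; case: (b); [right|left].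
  by case.
rewrite /inner_chain crs fsbigU0; [|exact: finite_set1|exact: finite_set1|]; last first.
  by move=> q [-> /= E]; case: pne.
rewrite !fsbig_set1 /crossing_term (gc false).1 (gc true).1.
(* The same strand is over at both crossings, but the difference of slopes changes sign. *)
have nuE : ~~ (0 < det2 (heading cq cr e k (xi true)) (heading cq cr e l (xi true))) = ~~ nu false.
  rewrite /nu; congr (~~ _); rewrite !det2_heading !sl expr0 expr1 mul1r mulN1r mulrN oppr_gt0 -leNgt.
  by rewrite lt_neqAle (mulf_neq0 _ a0) ?signr_eq0.
rewrite nuE.
pose K b x y := side_color C D (p b) x y.
(* The exceptional corner is the one in the disconnected sector, below graph 0 and above graph 1. *)
apply: (@cross_chain_cancel _ _ _ _ _ (K false) (K true) (nu false) (e k (+) (k == 0)) (e l (+) (l == 0)) hX).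
- exact: hC (cp false).
- exact: hC (cp true).
move=> a b ne.
pose s (j : 'I_2) := if j == k then e k (+) a else e l (+) b.
have sk : s k = e k (+) a by rewrite /s eqxx.
have sl' : s l = e l (+) b by rewrite /s eq_sym (negPf kl).
have ns : ~~ (s 0 && ~~ s 1).
  apply: contra_neqN ne => /andP[s0 s1].
  have sj (j : 'I_2) : s j = (j == 0).
    by case: (ord2_cases j) => ->; rewrite ?s0 ?(negPf s1).
  congr (_, _).
    by rewrite -(sj k) sk addbA addbb.
  by rewrite -(sj l) sl' addbA addbb.
have st := crossed_star ns.
rewrite /K !((gc _).2 _ C a b s _ sk sl' _ st) //; by
  move=> j; case: (kl2 j) => ->; rewrite eqxx.
Qed.

End MoveTwo.

(** * Third move: sectors and vertices of the triangle *)

Section Triangle.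
Context (R : realType).

Definition triangle_q (s : bool) (k : nat) : R := nth 0 [:: 0; 0; - ((-1) ^+ s / 2)] k.
Definition triangle_r (k : nat) : R := nth 0 [:: 4 / 3; - (4 / 3); 0] k.
Definition triangle_d (s : bool) (k : nat) : R := nth 0 [:: 0; 0; (-1) ^+ s / 2] k.
Local Notation tquad s := (quad (triangle_q s) triangle_r (triangle_d s)).
Local Notation tslope s := (slope (triangle_q s) triangle_r).

Lemma triangle_quad s : triangle s = tquad s.
Proof.
apply: funext => k; apply: funext => x; rewrite /triangle /quad /triangle_q /triangle_r /triangle_d.
by case: k => [|[|[|k]]] /=; rewrite ?nth_nil; field.
Qed.

(* The crossing of the two strands other than the [m]-th. *)
Definition vertex_x (s : bool) (m : nat) : R :=
  nth 0 [:: - ((-1) ^+ s / 3); (-1) ^+ s / 3; 0] m.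

(* Whether the [l]-th graph is the steeper one where it meets the [k]-th. *)
Definition slope_lt (k l : nat) : bool := (k == 1%N) || ((k == 2%N) && (l == 0%N)).
(** Whether the crossing of the other two graphs lies below the [m]-th one. The move flips this for
    all three graphs. *)
Definition third_below (s : bool) (m : nat) : bool := s (+) (m == 2%N).

Lemma vertexP s (k l m : 'I_3) (x := vertex_x s m) : k != l -> k != m -> l != m ->
  [/\ tquad s l x = tquad s k x, x ^+ 2 + tquad s k x ^+ 2 < 1,
      0 < (-1) ^+ (~~ slope_lt k l) * (tslope s l x - tslope s k x)
    & 0 < (-1) ^+ third_below s m * (tquad s k x - tquad s m x)].
Proof.
rewrite {}/x /quad /slope /vertex_x /triangle_q /triangle_r /triangle_d /slope_lt /third_below.
case: k => [[|[|[|//]]] hk]; case: l => [[|[|[|//]]] hl]; case: m => [[|[|[|//]]] hm] //= _ _ _;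
  by case: s; rewrite /= ?expr0 ?expr1; split; lra.
Qed.

Definition vertex_y (s : bool) (m : nat) : R :=
  nth 0 [:: (-1) ^+ s * (4 / 9); (-1) ^+ s * (4 / 9); 0] m.

Lemma vertex_yE s (k m : 'I_3) : k != m -> tquad s k (vertex_x s m) = vertex_y s m.
Proof.
rewrite /quad /vertex_x /vertex_y /triangle_q /triangle_r /triangle_d.
by case: k => [[|[|[|//]]] hk]; case: m => [[|[|[|//]]] hm] //= _;
  case: s; rewrite /= ?expr0 ?expr1; lra.
Qed.

Lemma vertex_x_inj s (m m' : 'I_3) : vertex_x s m = vertex_x s m' -> m = m'.
Proof.
rewrite /vertex_x; case: m => [[|[|[|//]]] hm]; case: m' => [[|[|[|//]]] hm'] /= E;
  (try by apply: val_inj); by exfalso; move: E; case: s; rewrite ?expr0 ?expr1; lra.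
Qed.

Lemma vertex_unique s (k l m : 'I_3) (x : R) : k != l -> k != m -> l != m -> x ^+ 2 <= 1 ->
  tquad s k x = tquad s l x -> x = vertex_x s m.
Proof.
(* The other root, [- 3 * a], is outside the disk. *)
have root (a : R) : x ^+ 2 <= 1 -> a ^+ 2 = 1 -> x ^+ 2 + 8 / 3 * a * x - 1 = 0 -> x = a / 3.
  move=> x1 a1 E; have : (x - a / 3) * (x + 3 * a) = 0 by rewrite -[RHS]E; move: a1; nra.
  move/eqP; rewrite mulf_eq0 subr_eq0 addr_eq0 => /orP[|] /eqP // xE.
  by move: x1; rewrite xE; nra.
rewrite /quad /vertex_x /triangle_q /triangle_r /triangle_d.
case: k => [[|[|[|//]]] hk]; case: l => [[|[|[|//]]] hl]; case: m => [[|[|[|//]]] hm] //= _ _ _ x1 E.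
- by lra.
- by apply: root => //; rewrite ?sqrr_sign //; case: s E; rewrite ?expr0 ?expr1 => E; lra.
- by lra.
- by rewrite -mulNr; apply: root => //; rewrite ?sqrrN ?sqrr_sign //; case: s E; rewrite ?expr0 ?expr1 => E; lra.
- by apply: root => //; rewrite ?sqrr_sign //; case: s E; rewrite ?expr0 ?expr1 => E; lra.
- by rewrite -mulNr; apply: root => //; rewrite ?sqrrN ?sqrr_sign //; case: s E; rewrite ?expr0 ?expr1 => E; lra.
Qed.

(* Except for the two central ones, the points lie on the unit circle and in
   the same sector before and after the move. *)
Definition triangle_center (b0 b1 b2 : bool) : 'rV[R]_2 :=
  if b0 (+) b1 then pt ((-1) ^+ b1 * (4 / 5)) ((-1) ^+ b2 * (3 / 5))
  else pt 0 ((-1) ^+ b0 * (if b0 (+) b2 then 1 / 4 else 1)).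

(* Also true, vacuously, for the empty sector. *)
Lemma triangle_star s (b : 'I_3 -> bool) :
  star (sector (triangle_q s) triangle_r (triangle_d s) b)
    (triangle_center (b ord0) (b (inord 1)) (b (inord 2))).
Proof.
apply: star_sector.
  rewrite /unit_disk /triangle_center; case: (_ (+) _); rewrite /= pt0 pt1 ?exprMn ?sqrr_sign; first by lra.
  by rewrite expr0n /= mul1r; case: (_ (+) _); rewrite ?expr1n; lra.
have o1 : nat_of_ord (inord 1 : 'I_3) = 1%N by rewrite inordK.
have o2 : nat_of_ord (inord 2 : 'I_3) = 2%N by rewrite inordK.
move=> z [+ hs] j; have := hs (inord 2); have := hs (inord 1); have := hs ord0.
clear hs.
have j3 : j = ord0 \/ j = inord 1 \/ j = inord 2.
  case: j => [[|[|[|//]]] hj]; [left|right; left|right; right]; apply: val_inj => /=; by rewrite ?inordK.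
rewrite /unit_disk /quad /triangle_q /triangle_r /triangle_d /triangle_center o1 o2 /=.
move: (z 0 0) (z 0 1) => x y; rewrite !mul0r !add0r !addr0.
case: j3 => [->|[->|->]]; rewrite ?o1 ?o2 /=; case: (b ord0); case: (b (inord 1)); case: (b (inord 2)) => /=;
  rewrite ?pt0 ?pt1 ?expr0 ?expr1; case: s; rewrite ?expr0 ?expr1 => h0 h1 h2 dz; split; nra.
Qed.

Lemma triangle_center_sector s (b : 'I_3 -> bool) :
  ~~ [&& b ord0, b (inord 1) & ~~ b (inord 2)] ->
  ~~ [&& ~~ b ord0, ~~ b (inord 1) & b (inord 2)] ->
  let z := triangle_center (b ord0) (b (inord 1)) (b (inord 2)) in
  unit_circle z /\ sector (triangle_q s) triangle_r (triangle_d s) b z.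
Proof.
move=> n1 n2 z.
suff [cz hz] : unit_circle z /\ forall j : 'I_3, 0 < (-1) ^+ b j * (z 0 1 - tquad s j (z 0 0)).
  by split => //; split => //; rewrite /unit_disk /= cz.
have o1 : nat_of_ord (inord 1 : 'I_3) = 1%N by rewrite inordK.
have o2 : nat_of_ord (inord 2 : 'I_3) = 2%N by rewrite inordK.
have j3 (j : 'I_3) : j = ord0 \/ j = inord 1 \/ j = inord 2.
  case: j => [[|[|[|//]]] hj]; [left|right; left|right; right]; apply: val_inj => /=; by rewrite ?inordK.
rewrite /z /unit_circle /= /quad /triangle_q /triangle_r /triangle_d /triangle_center.
split=> [|j].
  move: n1 n2; case: (b ord0); case: (b (inord 1)); case: (b (inord 2)) => //= _ _;
  rewrite ?pt0 ?pt1 ?expr0 ?expr1; lra.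
move: n1 n2; case: (j3 j) => [->|[->|->]]; rewrite ?o1 ?o2 /=;
  case: (b ord0); case: (b (inord 1)); case: (b (inord 2)) => //= _ _;
  rewrite ?pt0 ?pt1 ?expr0 ?expr1; case: s; rewrite ?expr0 ?expr1; lra.
Qed.

End Triangle.

Section TriangleChain.
Context (X : choiceType).
Context (R : realType) (F : topologicalType) (S : oriented_surface R F).
Context (U : set F) (c : chart R F) (hU : disk_chart S U c) (D : diagram S) (C : set F -> X).
Context (e : 'I_3 -> bool) (h : 'S_3) (s : bool).
Hypothesis hl : looks_like c D (graphs (triangle s) e h).

Definition vertex (m : 'I_3) : F := chart_inv c (pt (vertex_x R s m) (vertex_y R s m)).

(** For the sector missing from the diagram the chosen point lies in a neighbouring sector, and the
    value has no meaning. *)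
Definition sector_color (b : 'I_3 -> bool) : X :=
  C (region D (chart_inv c (triangle_center R (b ord0) (b (inord 1)) (b (inord 2))))).

Let hl' : looks_like c D (graphs (quad (triangle_q R s) (triangle_r R) (triangle_d R s)) e h).
Proof. by rewrite -triangle_quad. Qed.

Lemma triangle_crossings (k l m : 'I_3) : (h m < h l)%N -> (h l < h k)%N ->
  crossings D `&` U = [set vertex m] `|` ([set vertex l] `|` [set vertex k]).
Proof.
move=> ml lk; have mk := ltn_trans ml lk.
have ne (i j : 'I_3) : (h i < h j)%N -> j != i.
  by move=> lt; apply: contraTneq lt => ->; rewrite ltnn.
have klm (i : 'I_3) : [\/ i = m, i = l | i = k].
  move: (ne _ _ ml) (ne _ _ lk) (ne _ _ mk).
  case: i => [[|[|[|//]]] hi]; case: (k) => [[|[|[|//]]] hk]; case: (l) => [[|[|[|//]]] hl0];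
    case: (m) => [[|[|[|//]]] hm] //= _ _ _;
    by [apply: Or31; apply: val_inj | apply: Or32; apply: val_inj | apply: Or33; apply: val_inj].
rewrite (graph_crossings hU hl'); apply/seteqP; split.
  move=> _ [i [j [x [dz E lt ->]]]].
  have ij := ne _ _ lt.
  have [n [ni nj]] : exists n : 'I_3, i != n /\ j != n.
    move: ij; case: (i) => [[|[|[|//]]] hi]; case: (j) => [[|[|[|//]]] hj] //= _.
    - by exists (Ordinal (isT : (2 < 3)%N)).
    - by exists (Ordinal (isT : (1 < 3)%N)).
    - by exists (Ordinal (isT : (2 < 3)%N)).
    - by exists (Ordinal (isT : (0 < 3)%N)).
    - by exists (Ordinal (isT : (1 < 3)%N)).
    - by exists (Ordinal (isT : (0 < 3)%N)).
  have x1 : x ^+ 2 <= 1.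
    by apply: le_trans dz; rewrite /= pt0 pt1 lerDl sqr_ge0.
  have -> := vertex_unique ij ni nj x1 (esym E).
  rewrite (vertex_yE R s ni) -/(vertex n).
  by case: (klm n) => ->; [left | right; left | right; right].
have vert (i j n : 'I_3) : (h j < h i)%N -> i != n -> j != n ->
    exists (k l : 'I_3) (x : R), [/\ unit_disk (pt x (quad (triangle_q R s) (triangle_r R) (triangle_d R s) k x)),
      quad (triangle_q R s) (triangle_r R) (triangle_d R s) l x = quad (triangle_q R s) (triangle_r R) (triangle_d R s) k x,
      (h l < h k)%N & vertex n = chart_inv c (pt x (quad (triangle_q R s) (triangle_r R) (triangle_d R s) k x))].
  move=> lt ni nj; exists i, j, (vertex_x R s n).
  have [E d _ _] := @vertexP R s i j n (ne _ _ lt) ni nj.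
  by split => //; [rewrite /unit_disk /= pt0 pt1 ltW | rewrite (vertex_yE R s ni)].
move=> p [->|[->|->]]; [apply: (vert k l) | apply: (vert k m) | apply: (vert l m)] => //;
  by [apply: ne | rewrite eq_sym; apply: ne].
Qed.

Lemma vertex_inj (m n : 'I_3) : vertex m = vertex n -> m = n.
Proof.
have dz (i : 'I_3) : unit_disk (pt (vertex_x R s i) (vertex_y R s i)).
  rewrite /unit_disk /= pt0 pt1 /vertex_x /vertex_y.
  by case: i => [[|[|[|//]]] hi] /=; rewrite ?sqrrN ?exprMn ?sqrr_sign; lra.
move=> E; have [_ Em _] := disk_inv hU (dz m); have [_ En _] := disk_inv hU (dz n).
have := congr1 (chart_map c) E; rewrite Em En => /(congr1 (fun z : 'rV[R]_2 => z 0 0)).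
by rewrite !pt0; exact: vertex_x_inj.
Qed.

Lemma triangle_sum (k l m : 'I_3) : (h m < h l)%N -> (h l < h k)%N ->
  inner_chain C U D = crossing_term C D (vertex m) + crossing_term C D (vertex l)
    + crossing_term C D (vertex k).
Proof.
move=> ml lk; have mk := ltn_trans ml lk.
have ne (i j : 'I_3) : (h i < h j)%N -> vertex i = vertex j -> False.
  by move=> lt /vertex_inj E; rewrite E ltnn in lt.
rewrite /inner_chain (triangle_crossings ml lk) fsbigU0; first last.
- by move=> p [-> [/= E|/= E]]; [exact: ne ml E | exact: ne mk E].
- by rewrite finite_setU; split; exact: finite_set1.
- exact: finite_set1.
rewrite fsbigU0; first last.
- by move=> p [-> /= E]; exact: ne lk E.
- exact: finite_set1.
- exact: finite_set1.
by rewrite !fsbig_set1 /= addrA.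
Qed.

(** All corners at a crossing lie on one side of the third graph. This fixes [b m], while [b k] and
    [b l] run over a face of the cube. *)
Lemma triangle_vertex (k l m : 'I_3) : k != l -> k != m -> l != m -> (h l < h k)%N ->
  [/\ crossings D (vertex m),
    crossing_sign D (vertex m) = (-1) ^+ (e k (+) e l (+) ~~ slope_lt k l)
  & forall (x y : bool) (b : 'I_3 -> bool), b k = e k (+) x -> b l = e l (+) y ->
      b m = third_below s m -> side_color C D (vertex m) x y = sector_color b].
Proof.
move=> kl km lm lt.
have [E d dsl third] := vertexP R s kl km lm.
have others (j : 'I_3) : j != k -> j != l -> j = m.
  move: kl km lm; case: (j) => [[|[|[|//]]] hj]; case: (k) => [[|[|[|//]]] hk];
    case: (l) => [[|[|[|//]]] hl0]; case: (m) => [[|[|[|//]]] hm] //= _ _ _ _ _; exact: val_inj.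
have nsl : slope (triangle_q R s) (triangle_r R) k (vertex_x R s m) !=
    slope (triangle_q R s) (triangle_r R) l (vertex_x R s m).
  by apply: contraTneq dsl => ->; rewrite subrr mulr0 ltxx.
have nj (j : 'I_3) : j != k -> j != l ->
    quad (triangle_q R s) (triangle_r R) (triangle_d R s) j (vertex_x R s m) !=
    quad (triangle_q R s) (triangle_r R) (triangle_d R s) k (vertex_x R s m).
  move=> jk jl; rewrite (others j jk jl).
  by apply: contraTneq third => ->; rewrite subrr mulr0 ltxx.
have [hs hc] := graph_crossing hU hl' d E lt nsl nj.
rewrite (vertex_yE R s km) -/(vertex m) in hs hc.
split.
- have : (crossings D `&` U) (vertex m).
    rewrite (graph_crossings hU hl'); exists k, l, (vertex_x R s m).
    by split => //; [rewrite /unit_disk /= pt0 pt1 ltW | rewrite (vertex_yE R s km)].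
  by case.
- rewrite hs det2_heading.
  have sg (g b : bool) (a : R) : 0 < (-1) ^+ b * a -> ~~ (0 < (-1) ^+ g * a) = g (+) b.
    by case: g; case: b; rewrite /= ?expr0 ?expr1 ?mul1r ?mulN1r ?oppr_gt0 => h0;
      rewrite ?h0 // -leNgt ltW.
  by rewrite (sg _ _ _ dsl).
- move=> x y b bk bl bm; rewrite /sector_color; apply: (hc X C x y b _ bk bl _ (@triangle_star R s b)) => j jk jl.
  by rewrite (others j jk jl) bm -(vertex_yE R s km).
Qed.

End TriangleChain.

(** * Third move: coloring the cube *)

Section MoveThree.
Context (X : choiceType) (T : X -> X -> X -> X).
Context (R : realType) (F : topologicalType) (S : oriented_surface R F).
Context (U : set F) (c c' : chart R F) (hU : disk_chart S U c) (hU' : disk_chart S U c').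
Hypothesis hcc : forall x, unit_circle x -> chart_inv c x = chart_inv c' x.
Context (D D' : diagram S) (C C' : set F -> X).
Context (e : 'I_3 -> bool) (h : 'S_3).
Hypotheses (hl : looks_like c D (graphs (triangle false) e h))
           (hl' : looks_like c' D' (graphs (triangle true) e h)).
Hypotheses (hC : is_coloring T D C) (hC' : is_coloring T D' C').
Hypothesis agr : agree_off U D D' C C'.

Lemma sector_color_agree (b : 'I_3 -> bool) :
  ~~ [&& b ord0, b (inord 1) & ~~ b (inord 2)] ->
  ~~ [&& ~~ b ord0, ~~ b (inord 1) & b (inord 2)] ->
  sector_color c D C b = sector_color c' D' C' b.
Proof.
move=> n1 n2; rewrite /sector_color.
have [cz sz] := triangle_center_sector R false n1 n2.
have [_ sz'] := triangle_center_sector R true n1 n2.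
set z := triangle_center _ _ _ in cz sz sz' *.
rewrite -(hcc cz); apply: (circle_color hU agr cz).
  by move: hl; rewrite triangle_quad => hq /(disk_support hU hq sz.1)[k [t]]; exact: sector_arc sz.
rewrite (hcc cz).
by move: hl'; rewrite triangle_quad => hq /(disk_support hU' hq sz'.1)[k [t]]; exact: sector_arc sz'.
Qed.

(* Each of the two diagrams shows seven of the eight sectors; the sector below
   the two lines and above the arc exists only after the move. *)
Let cube_color (b : 'I_3 -> bool) : X :=
  if [&& b ord0, b (inord 1) & ~~ b (inord 2)] then sector_color c' D' C' b
  else sector_color c D C b.

Let third_cases (m : 'I_3) : [\/ m = ord0, m = inord 1 | m = inord 2].
Proof.
case: m => [[|[|[|//]]] hm]; [apply: Or31|apply: Or32|apply: Or33]; apply: val_inj => //=;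
  by rewrite inordK.
Qed.

(** The condition on [b m] holds for sectors at a crossing of [D], and it fails for every [m] in the
    sector that [D] lacks. *)
Let cube_colorE (m : 'I_3) b : b m = third_below false m -> sector_color c D C b = cube_color b.
Proof.
rewrite /cube_color /third_below => bm.
case: ifP => // /and3P[b0 b1 b2].
by move: bm; case: (third_cases m) => ->; rewrite ?inordK //= ?b0 ?b1 ?(negPf b2).
Qed.

Let cube_colorE' (m : 'I_3) b : b m = third_below true m -> sector_color c' D' C' b = cube_color b.
Proof.
rewrite /cube_color /third_below => bm.
case: ifP => // /negbT n1; symmetry; apply: sector_color_agree n1 _.
apply/negP => /and3P[b0 b1 b2].
by move: bm; case: (third_cases m) => ->; rewrite ?inordK //= ?(negPf b0) ?(negPf b1) ?b2.
Qed.

Lemma triangle_homologous : homologous T (inner_chain C U D) (inner_chain C' U D').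
Proof.
pose t := (h^-1)%g (inord 2); pose m := (h^-1)%g (inord 1); pose b := (h^-1)%g ord0.
have mt : (h m < h t)%N by rewrite /m /t !permKV !inordK.
have bm : (h b < h m)%N by rewrite /b /m !permKV !inordK.
have bt := ltn_trans bm mt.
have ne (i j : 'I_3) : (h i < h j)%N -> j != i.
  by move=> lt; apply: contraTneq lt => ->; rewrite ltnn.
have tm := ne _ _ mt; have mb := ne _ _ bm; have tb := ne _ _ bt.
have mt' : m != t by rewrite eq_sym.
have bm' : b != m by rewrite eq_sym.
have bt' : b != t by rewrite eq_sym.
have [p1 s1 k1] := triangle_vertex hU C hl tm tb mb mt.
have [p2 s2 k2] := triangle_vertex hU C hl tb tm bm' bt.
have [p3 s3 k3] := triangle_vertex hU C hl mb mt' bt' bm.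
have [q1 r1 l1] := triangle_vertex hU' C' hl' tm tb mb mt.
have [q2 r2 l2] := triangle_vertex hU' C' hl' tb tm bm' bt.
have [q3 r3 l3] := triangle_vertex hU' C' hl' mb mt' bt' bm.
rewrite (triangle_sum hU C hl bm mt) (triangle_sum hU' C' hl' bm mt).
(* Translation from left and right of the strands, ordered by height, to above and below the graphs,
   ordered by index. *)
pose rho x y z (j : 'I_3) := e j (+) (if j == t then x else if j == m then y else z).
have rt x y z : rho x y z t = e t (+) x by rewrite /rho eqxx.
have rm x y z : rho x y z m = e m (+) y by rewrite /rho eqxx (negPf mt').
have rb x y z : rho x y z b = e b (+) z by rewrite /rho (negPf bt') (negPf bm').
pose K x y z := cube_color (rho x y z).
(* The side of the [j]-th strand on which the other two cross before the move; afterwards it is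
   [~~ u j]. *)
pose u (j : 'I_3) := e j (+) third_below false j.
have uE (j : 'I_3) : e j (+) u j = third_below false j by rewrite /u addbA addbb.
have uE' (j : 'I_3) : e j (+) ~~ u j = third_below true j by rewrite addbN uE.
have K1 x y : side_color C D (vertex c false b) x y = K x y (u b).
  rewrite (k1 x y (rho x y (u b))) ?rt ?rm ?rb ?uE //.
  by apply: (@cube_colorE b); rewrite rb uE.
have K2 x y : side_color C D (vertex c false m) x y = K x (u m) y.
  rewrite (k2 x y (rho x (u m) y)) ?rt ?rm ?rb ?uE //.
  by apply: (@cube_colorE m); rewrite rm uE.
have K3 x y : side_color C D (vertex c false t) x y = K (u t) x y.
  rewrite (k3 x y (rho (u t) x y)) ?rt ?rm ?rb ?uE //.
  by apply: (@cube_colorE t); rewrite rt uE.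
have L1 x y : side_color C' D' (vertex c' true b) x y = K x y (~~ u b).
  rewrite (l1 x y (rho x y (~~ u b))) ?rt ?rm ?rb ?uE' //.
  by apply: (@cube_colorE' b); rewrite rb uE'.
have L2 x y : side_color C' D' (vertex c' true m) x y = K x (~~ u m) y.
  rewrite (l2 x y (rho x (~~ u m) y)) ?rt ?rm ?rb ?uE' //.
  by apply: (@cube_colorE' m); rewrite rm uE'.
have L3 x y : side_color C' D' (vertex c' true t) x y = K (~~ u t) x y.
  rewrite (l3 x y (rho (~~ u t) x y)) ?rt ?rm ?rb ?uE' //.
  by apply: (@cube_colorE' t); rewrite rt uE'.
(* Of two opposite faces of the cube one is a crossing of [D] and the other a crossing of [D'], so
   each coloring provides three of the six rules. *)
have both (P : bool -> Prop) a : P a -> P (~~ a) -> forall x, P x.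
  by case: a => p0 p1' [].
have h1 : forall x, K false true x = T (K false false x) (K true false x) (K true true x).
  apply: (both _ (u b)); first by rewrite -!K1; exact: hC p1.
  by rewrite -!L1; exact: hC' q1.
have h2 : forall x, K false x true = T (K false x false) (K true x false) (K true x true).
  apply: (both _ (u m)); first by rewrite -!K2; exact: hC p2.
  by rewrite -!L2; exact: hC' q2.
have h3 : forall x, K x false true = T (K x false false) (K x true false) (K x true true).
  apply: (both _ (u t)); first by rewrite -!K3; exact: hC p3.
  by rewrite -!L3; exact: hC' q3.
(* Defined by the sign of the crossing of the two upper strands; that the other two signs fit is
   checked for all orders of heights and all orientations. *)
pose eta := e t (+) e m (+) ~~ slope_lt t m (+) u b.
have n1 : e t (+) e m (+) ~~ slope_lt t m = eta (+) u b by rewrite /eta; case: (u b); rewrite ?addbF ?addbT ?negbK.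
have [n2 n3] : e t (+) e b (+) ~~ slope_lt t b = ~~ eta (+) u m /\
    e m (+) e b (+) ~~ slope_lt m b = eta (+) u t.
  rewrite /eta /u; move: tm mb tb; clear.
  case: t => [[|[|[|//]]] ?]; case: m => [[|[|[|//]]] ?]; case: b => [[|[|[|//]]] ?] //= _ _ _;
  by rewrite /slope_lt /third_below /=; case: (e _); case: (e _); case: (e _).
have := cube_chain eta (u b) (u m) (u t) h1 h2 h3; rewrite /= -n1 -n2 -n3.
rewrite -!K1 -!K2 -!K3 -!L1 -!L2 -!L3.
rewrite /crossing_term s1 s2 s3 r1 r2 r3; exact.
Qed.

End MoveThree.

Lemma agree_off_sym (X : choiceType) (R : realType) (F : topologicalType)
    (S : oriented_surface R F) (U : set F) (D D' : diagram S) (C C' : set F -> X) :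
  agree_off U D D' C C' -> agree_off U D' D C' C.
Proof. by move=> agr p nU nD nD'; rewrite agr. Qed.

Theorem lemma3p5 (X : choiceType) (T L M N : X -> X -> X -> X)
    (hX : is_KTQ T L M N)
    (R : realType) (F : topologicalType) (S : oriented_surface R F)
    (hF : compact [set: F] \/ is_plane S)
    (k : move_kind) (U : set F) (D D' : diagram S)
    (hD : reidemeister_move k U D D')
    (C C' : set F -> X)
    (hC : is_coloring T D C) (hC' : is_coloring T D' C')
    (hCC' : agree_off U D D' C C') :
  homologousN T L N (diagram_chain D C) (diagram_chain D' C') /\
  (k = RII \/ k = RIII ->
   homologous T (diagram_chain D C) (diagram_chain D' C')).
Proof.
case: hD => [c [c' [m [m' [[hU hU'] hcc hm [hl hl'] hout]]]]].
have E := chain_diff (disk_closed hU) hCC' hout.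
have strong : homologous T (inner_chain C U D) (inner_chain C' U D') ->
    homologousN T L N (diagram_chain D C) (diagram_chain D' C') /\
    (k = RII \/ k = RIII -> homologous T (diagram_chain D C) (diagram_chain D' C')).
  move=> [w hw]; have h : homologous T (diagram_chain D C) (diagram_chain D' C').
    by exists w; rewrite E.
  by split => //; exact: homologousW.
have zero : inner_chain C U D = 0 -> inner_chain C' U D' = 0 ->
    homologous T (inner_chain C U D) (inner_chain C' U D').
  by move=> -> ->; exists 0; rewrite subrr boundary0.
(* Three kinds of move, each in both directions. For RI the difference of the chains is itself
   degenerate, hence the witness 0. *)
case: hm => hm; case: hm hl hl' strong => [e w|e h|e h] hl hl' strong.
- split; last by case.
  exists 0; rewrite E boundary0 subr0 (chord_chain hU C hl) sub0r.
  exact: degenerate_chainN (kink_chain hX hU' hl' hC').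
- apply/strong/zero; first exact: (parallel_chain hU C hl).
  exact: (crossed_chain hX hU' hl' hC').
- exact/strong/(triangle_homologous hU hU' hcc hl hl' hC hC' hCC').
- split; last by case.
  exists 0; rewrite E boundary0 subr0 (chord_chain hU' C' hl') subr0.
  exact: (kink_chain hX hU hl hC).
- apply/strong/zero; last exact: (parallel_chain hU' C' hl').
  exact: (crossed_chain hX hU hl hC).
- apply: strong.
  have [w hw] := triangle_homologous hU' hU (fun x cx => esym (hcc x cx)) hl' hl hC' hC
    (agree_off_sym hCC').
  by exists (- w); rewrite boundaryN -hw opprB.
Qed.
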